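(* Assume: (a) $r$ and $\sigma_{\varepsilon}^2$ are continuous in a neighborhood of $\chi$, and $F(0)=0$; (b) $\varphi'(0)$ exists; (c) the bandwidth $h=h_n$ satisfies $\lim_{n\to\infty}h=0$ and $\lim_{n\to\infty}nF(h)=\infty$, and the kernel $K$ is supported on $[0,1]$, has a continuous derivative on $[0,1)$, $K'(s)\le 0$ and $K(1)>0$; (d) for all $s\in[0,1]$, $\tau_h(s)\to\tau_0(s)$ as $h\to0$. Then, as $n\to\infty$, $$E\,\widehat r(\chi)-r(\chi)=\varphi'(0)\frac{M_0}{M_1}h+O\left(\frac{1}{nF(h)}\right)+o(h),$$ and $$\mathrm{Var}\left(\widehat r(\chi)\right)=\frac{1}{nF(h)}\frac{M_2}{M_1^2}\sigma_{\varepsilon}^2(\chi)+o\left(\frac{1}{nF(h)}\right).$$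
   Context: $\mathcal E$ is a separable Banach space with norm $\|\cdot\|$. $(Y_i,\mathcal X_i)_{i=1,\dots,n}$ is a sample of i.i.d. pairs (with generic copy $(Y,\mathcal X)$), where $Y_i$ is real-valued and $\mathcal X_i$ takes values in $\mathcal E$, satisfying $Y_i=r(\mathcal X_i)+\varepsilon_i$ with $r:\mathcal E\to\mathbb R$, $E(\varepsilon_i\mid\mathcal X_i)=0$ and $E(\varepsilon_i^2\mid\mathcal X_i)=\sigma_\varepsilon^2(\mathcal X_i)<\infty$. The point $\chi\in\mathcal E$ is fixed. Define, for $s\ge0$, $\varphi(s)=E[r(\mathcal X)-r(\chi)\mid\|\mathcal X-\chi\|=s]$ (so $\varphi(0)=0$), and let $F(t)=P(\|\mathcal X-\chi\|\le t)$. For $h>0$ and $s\in[0,1]$ let $\tau_h(s)=F(hs)/F(h)=P(\|\mathcal X-\chi\|\le hs\mid\|\mathcal X-\chi\|\le h)$, and let $\tau_0$ denote the pointwise limit of $\tau_h$ as $h\to0$. The kernel estimate with kernel $K$ and bandwidth $h=h_n>0$ is $$\widehat r(\chi)=\frac{\sum_{k=1}^nY_kK(h^{-1}\|\mathcal X_k-\chi\|)}{\sum_{k=1}^nK(h^{-1}\|\mathcal X_k-\chi\|)}.$$ The constants are $M_0=K(1)-\int_0^1(sK(s))'\tau_0(s)\,ds$, $M_1=K(1)-\int_0^1K'(s)\tau_0(s)\,ds$, $M_2=K^2(1)-\int_0^1(K^2)'(s)\tau_0(s)\,ds$.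
   Formalization: The kernel K is additionally assumed continuous on [0,1], i.e. K(1) equals its left limit at 1; with a jump at 1 the claim fails (K=1 on [0,1), K(1)=2, τ_0(s)=s: true bias ratio 1/2, but M_0/M_1=3/4). *)

(* Defs.v *)
From HB Require Import structures.
From mathcomp Require Import all_boot all_order all_algebra.
From mathcomp Require Import all_classical all_reals all_analysis.

Set Implicit Arguments.
Unset Strict Implicit.
Unset Printing Implicit Defensive.

Import Order.TTheory GRing.Theory Num.Theory.
Import numFieldNormedType.Exports.

Local Open Scope classical_set_scope.
Local Open Scope ring_scope.

Definition separable (T : topologicalType) := exists2 S : set T, countable S & dense S.

Notation borel T := (g_sigma_algebraType (@open T)).

Section probability.
Context (d d' : measure_display) (Omega : measurableType d)
  (T : measurableType d') (R : realType) (P : probability Omega R).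

Definition mutually_independent (Z : nat -> Omega -> T) :=
  forall (s : seq nat) (A : nat -> set T),
    uniq s -> (forall i, measurable (A i)) ->
    P (\bigcap_(i in [set` s]) Z i @^-1` A i) =
      (\prod_(i <- s) fine (P (Z i @^-1` A i)))%:E.

Definition iid_copies (Z_ : nat -> Omega -> T) (Z : Omega -> T) :=
  [/\ measurable_fun setT Z,
      forall i, measurable_fun setT (Z_ i),
      forall i A, measurable A -> P (Z_ i @^-1` A) = P (Z @^-1` A)
    & mutually_independent Z_].

(* g is a version of x |-> E[U | V = x] *)
Definition is_cond_expectation (U : Omega -> R) (V : Omega -> T) (g : T -> R) :=
  [/\ P.-integrable setT (EFin \o U),
      measurable_fun setT g,
      P.-integrable setT (EFin \o (g \o V))
    & forall B, measurable B ->
        (\int[P]_(w in V @^-1` B) (U w)%:E =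
         \int[P]_(w in V @^-1` B) (g (V w))%:E)%E].

(* The same for U >= 0, when U need not be integrable: g is finite, but both
   integrals may be infinite. *)
Definition is_ge0_cond_expectation (U : Omega -> R) (V : Omega -> T)
    (g : T -> R) :=
  [/\ measurable_fun setT U /\ (forall w, 0 <= U w),
      measurable_fun setT g /\ (forall x, 0 <= g x)
    & forall B, measurable B ->
        (\int[P]_(w in V @^-1` B) (U w)%:E =
         \int[P]_(w in V @^-1` B) (g (V w))%:E)%E].

End probability.

Section calculus.
Context (R : realType).

(* Derivative at x along A: one-sided when x is an endpoint of A. *)
Definition has_derivative_within (A : set R) (f : R -> R) (x l : R) :=
  (f t - f x) / (t - x) @[t --> within A x^'] --> l.

(* Continuity on [0, 1] adds to differentiability on [0, 1) only that
   K 1 = K(1-). The boundary term K(1) of the constants M0, M1, M2 below comes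
   from an integration by parts, which needs this. *)
Definition admissible_kernel (K : R -> R) :=
  [/\ forall s, ~~ (0 <= s <= 1) -> K s = 0,
      {within `[0, 1], continuous K},
      exists K' : R -> R,
        [/\ forall s, 0 <= s < 1 -> has_derivative_within `[0, 1[ K s (K' s),
            {within `[0, 1[, continuous K'}
          & forall s, 0 <= s < 1 -> K' s <= 0]
    & 0 < K 1].

Local Notation mu := (@lebesgue_measure R).

(* The two-sided derivative [derive1] has no meaning at 0 and 1 for the functions
   below, but these two points are negligible. *)
Definition M0 (K tau0 : R -> R) : R :=
  K 1 - \int[mu]_(s in `[0, 1]) (derive1 (fun u => u * K u) s * tau0 s).

Definition M1 (K tau0 : R -> R) : R :=
  K 1 - \int[mu]_(s in `[0, 1]) (derive1 K s * tau0 s).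

Definition M2 (K tau0 : R -> R) : R :=
  K 1 ^+ 2 - \int[mu]_(s in `[0, 1]) (derive1 (fun u => K u ^+ 2) s * tau0 s).

End calculus.

Section regression.
Context (d : measure_display) (Omega : measurableType d) (R : realType)
  (P : probability Omega R) (E : completeNormedModType R).

Definition small_ball (X : Omega -> E) (chi : E) (t : R) : R :=
  fine (P [set w | `|X w - chi| <= t]).

Definition tau (F : R -> R) (h s : R) : R := F (h * s) / F h.

(* The sample is indexed from 0. The estimate is 0 when no X_ k lies in the
   closed ball of radius h (0 / 0 = 0). *)
Definition kernel_estimate (K : R -> R) (Y_ : nat -> Omega -> R)
    (X_ : nat -> Omega -> E) (chi : E) (h : R) (n : nat) (w : Omega) : R :=
  (\sum_(k < n) Y_ k w * K (h^-1 * `|X_ k w - chi|)) /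
  (\sum_(k < n) K (h^-1 * `|X_ k w - chi|)).

End regression.

(* Main.v *)
(* Let K_k = K(|X_k - chi| / h), S = sum_k K_k, W_k = K_k / S, rho = r - r(chi),
   c = E[rho(X) K_1] / E[K_1] and N = n F(h). Off the event S = 0,
     rhat - r(chi) - c = sum_k W_k eps_k + (sum_k K_k (rho(X_k) - c)) / S.
   As K(1) <= K <= K(0) on [0, 1], S is at least K(1) N / 4 except on an event
   that a Chernoff bound makes exponentially small in N; elsewhere S may be
   replaced by its mean at the cost of its variance, which is of order N.

   The second term is a ratio with a centered numerator: its mean is O(1 / N), and
   its second moment is o(1 / N) because rho is small near chi. The first term has
   mean 0 and orthogonal summands, each eps_k being centered given X_k and
   independent of the other observations; its variance E sum_k W_k^2 sigma^2(X_k)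
   is sigma^2(chi) E[K_1^2] / (n E[K_1]^2) + o(1 / N).

   Conditioning on |X - chi| replaces rho(X) by phi(|X - chi|) in c, where
   phi(s) = phi'(0) s + o(s). The expectations of s K(s), K(s) and K(s)^2 at
   s = |X - chi| / h, divided by F(h), are integrated by parts against tau_h and
   converge to M0, M1 and M2 by dominated convergence. *)
Require Import Defs.
From HB Require Import structures.
From mathcomp Require Import all_boot all_order all_algebra.
From mathcomp Require Import all_classical all_reals all_analysis.
From mathcomp Require Import measurable_realfun ring lra.

Set Implicit Arguments.
Unset Strict Implicit.
Unset Printing Implicit Defensive.

Import Order.TTheory GRing.Theory Num.Theory.
Import numFieldNormedType.Exports.

Local Open Scope classical_set_scope.
Local Open Scope ring_scope.

(** The noise is only known to be integrable: [sigma2] is finite, but neither [eps i ^+ 2] nor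
    [sigma2 (X_ i)] need be integrable; [sigma2] is bounded only near [chi], where the weights live.
    Conditional identities are therefore carried to weighted integrals of nonnegative functions,
    possibly infinite, and integrability is deduced afterwards; signed functions are split into
    their two parts. As [W_k] depends on every observation, independence is used as a product law of
    the k-th observation and the sigma-algebra of the others. Deviations of [S] and of [sum_k K_k^2]
    are controlled in mean square only; the inequality [2 |x| <= L x^2 + 1 / L] turns this into
    bounds in mean, with [L] growing more slowly than [N]. The exponential bound on the unlikely
    event is weakened to [64 / N^2]: even after the factor [N] lost to crude estimates there,
    [O(1 / N)] remains. The bounds for fixed [n] are explicit in a number [delta] that bounds the
    variation of [r] and [sigma2] on the ball, so the limits reduce to a choice of [delta]. *)

Lemma eq_integral_funrpos_funrneg (d : measure_display) (T : measurableType d)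
  (R : realType) (mu : {measure set T -> \bar R}) (D : set T) (f : T -> R) :
  measurable D -> mu.-integrable D (EFin \o f) ->
  (\int[mu]_(x in D) (f x)%:E = 0)%E ->
  (\int[mu]_(x in D) (f^\+ x)%:E = \int[mu]_(x in D) (f^\- x)%:E)%E.
Proof.
move=> mD intf; rewrite integralE.
rewrite -[X in integral _ _ X^\+%E]/(EFin \o f) funerpos.
rewrite -[X in integral _ _ X^\-%E]/(EFin \o f) funerneg.
move/eqP; rewrite sube_eq ?add0e => [/eqP//||].
- exact: (integrable_fin_num mD (integrable_funrpos mD intf)).
- by rewrite fin_num_adde_defr.
Qed.

(** * Integrals of real random variables *)

Section real_expectation.
Context (R : realType) (d : measure_display) (Omega : measurableType d)
  (P : probability Omega R).
Implicit Types f g : Omega -> R.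

Lemma integrable_measurable f : P.-integrable setT (EFin \o f) ->
  measurable_fun setT f.
Proof. by case/integrableP => /measurable_EFinP. Qed.

Lemma integrable_dominated f g : measurable_fun setT f ->
  (forall w, `|f w| <= g w) -> P.-integrable setT (EFin \o g) ->
  P.-integrable setT (EFin \o f).
Proof.
move=> mf fg; apply: le_integrable => //; first exact/measurable_EFinP.
by move=> w _; rewrite /= lee_fin (le_trans (fg w))// ler_norm.
Qed.

Lemma integrable_bounded f B : measurable_fun setT f ->
  (forall w, `|f w| <= B) -> P.-integrable setT (EFin \o f).
Proof.
move=> mf fB; apply: (integrable_dominated mf fB).
exact: (@finite_measure_integrable_cst _ _ _ P).
Qed.

Lemma integrable_add f g : P.-integrable setT (EFin \o f) ->
  P.-integrable setT (EFin \o g) ->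
  P.-integrable setT (EFin \o (fun w => f w + g w)).
Proof. by move=> intf intg; have := integrableD measurableT intf intg. Qed.

Lemma integrable_sub f g : P.-integrable setT (EFin \o f) ->
  P.-integrable setT (EFin \o g) ->
  P.-integrable setT (EFin \o (fun w => f w - g w)).
Proof. by move=> intf intg; have := integrableB measurableT intf intg. Qed.

Lemma integrable_scale k f : P.-integrable setT (EFin \o f) ->
  P.-integrable setT (EFin \o (fun w => k * f w)).
Proof. by move=> intf; have := integrableZl measurableT k intf. Qed.

Lemma integrable_sumr (I : Type) (s : seq I) (F : I -> Omega -> R) :
  (forall i, P.-integrable setT (EFin \o F i)) ->
  P.-integrable setT (EFin \o (fun w => \sum_(i <- s) F i w)).
Proof.
move=> iF; elim: s => [|i s IHs].
  rewrite (_ : _ \o _ = EFin \o (fun=> 0)); last first.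
    by apply/funext => w /=; rewrite big_nil.
  exact: (@finite_measure_integrable_cst _ _ _ P).
rewrite (_ : _ \o _ = EFin \o (fun w => F i w + \sum_(j <- s) F j w)).
  exact: integrable_add.
by apply/funext => w /=; rewrite big_cons.
Qed.

Lemma Rintegral_sum (I : Type) (s : seq I) (F : I -> Omega -> R) :
  (forall i, P.-integrable setT (EFin \o F i)) ->
  \int[P]_w (\sum_(i <- s) F i w) = \sum_(i <- s) \int[P]_w F i w.
Proof.
move=> iF; elim: s => [|i s IHs].
  rewrite big_nil (_ : (fun w => _) = fun=> 0).
    by rewrite Rintegral_cst// mul0r.
  by apply/funext => w; rewrite big_nil.
rewrite big_cons -IHs -RintegralD//; last exact: integrable_sumr.
by apply: eq_Rintegral => w _; rewrite big_cons.
Qed.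

Lemma Rintegral_indic (A : set Omega) : measurable A ->
  \int[P]_w \1_A w = fine (P A).
Proof. by move=> mA; rewrite /Rintegral integral_indic// setIT. Qed.

Lemma integrable_indicator (A : set Omega) : measurable A ->
  P.-integrable setT (EFin \o (\1_A : Omega -> R)).
Proof.
move=> mA; apply: (@integrable_bounded _ 1); first exact: measurable_indic.
by move=> w; rewrite indicE ger0_norm//; case: (_ \in _).
Qed.

Lemma Rintegral_prob_cst (k : R) : \int[P]_w k = k.
Proof.
rewrite Rintegral_cst//.
by rewrite -[X in fine X]/(P setT) probability_setT mulr1.
Qed.

Lemma EFin_Rintegral f : P.-integrable setT (EFin \o f) ->
  (\int[P]_w (f w)%:E)%E = (\int[P]_w f w)%:E.
Proof. by move=> intf; rewrite /Rintegral fineK//; exact: integrable_fin_num. Qed.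

End real_expectation.

(** * Independence *)

Section weighted.
Context (d d' : measure_display) (Omega : measurableType d)
  (T : measurableType d') (R : realType) (mu : {measure set Omega -> \bar R}).
Local Open Scope ereal_scope.
Import HBNNSimple.

(** On a level set of a simple function approximating [h] the weight is constant, and the hypothesis
    applies to its preimage; monotone convergence passes to the limit. Nonnegativity allows both
    sides to be infinite. *)
Lemma ge0_integral_weighted_eq (V : Omega -> T) (a b : Omega -> R) (h : T -> R) :
  measurable_fun setT V ->
  measurable_fun setT a -> (forall w, (0 <= a w)%R) ->
  measurable_fun setT b -> (forall w, (0 <= b w)%R) ->
  (forall B, measurable B ->
     \int[mu]_(w in V @^-1` B) (a w)%:E = \int[mu]_(w in V @^-1` B) (b w)%:E) ->
  measurable_fun setT h -> (forall x, (0 <= h x)%R) ->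
  \int[mu]_w (a w * h (V w))%:E = \int[mu]_w (b w * h (V w))%:E.
Proof.
move=> mV ma a0 mb b0 ab mh h0.
have mh' : measurable_fun [set: T] (fun x => (h x)%:E) by exact/measurable_EFinP.
pose g := nnsfun_approx measurableT mh'.
have gcvg x : (g n x)%:E @[n --> \oo] --> (h x)%:E.
  by apply: (cvg_nnsfun_approx measurableT mh') => // y _; rewrite lee_fin.
(* In this limit [c] enters only through its integrals over preimages under [V], on which [a] and
   [b] agree. *)
have key (c : Omega -> R) : measurable_fun setT c -> (forall w, (0 <= c w)%R) ->
    \int[mu]_w (c w * h (V w))%:E =
    limn (fun n => \sum_(y \in range (g n))
      y%:E * \int[mu]_(w in V @^-1` (g n @^-1` [set y])) (c w)%:E).
  move=> mc c0.
  transitivity (\int[mu]_w (limn (fun n => (c w * g n (V w))%:E))).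
    apply: eq_integral => w _; apply/esym/cvg_lim => //.
    rewrite EFinM; under eq_fun do rewrite EFinM.
    by apply: cvgeZl => //; exact: gcvg.
  rewrite monotone_convergence//; last 3 first.
  - move=> n; apply/measurable_EFinP/measurable_funM => //.
    exact: measurableT_comp.
  - by move=> n w _; rewrite lee_fin mulr_ge0.
  - move=> w _ m n mn; rewrite lee_fin ler_wpM2l//.
    exact/lefP/nd_nnsfun_approx.
  congr (limn _); apply/funext => n.
  transitivity (\int[mu]_w (\sum_(y \in range (g n))
     (y%:E * (c w * \1_(V @^-1` (g n @^-1` [set y])) w)%:E))).
    apply: eq_integral => w _; rewrite (fimfunE (g n)).
    rewrite EFinM -fsumEFin// ge0_mule_fsumr; last first.
      by move=> y; rewrite ?EFinM nnfun_muleindic_ge0.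
    apply: eq_fsbigr => y _; rewrite !EFinM muleCA; congr (_ * (_ * _)).
  rewrite ge0_integral_fsum//.
  - apply: eq_fsbigr => y; rewrite inE => -[x _ gxy].
    rewrite ge0_integralZl//.
    + congr (_ * _); rewrite [RHS]integral_mkcond; apply: eq_integral => w _.
      rewrite patchE indicE; case: ifPn => wV; rewrite ?mulr1 ?mulr0//.
    + apply/measurable_EFinP/measurable_funM => //.
      apply: measurable_indic; rewrite -[X in measurable X]setTI; exact: mV.
    + by move=> w _; rewrite lee_fin mulr_ge0.
    + by rewrite lee_fin -gxy.
  - move=> y; apply: measurable_funeM; apply/measurable_EFinP/measurable_funM => //.
    apply: measurable_indic; rewrite -[X in measurable X]setTI; exact: mV.
  - move=> y w _; rewrite EFinM muleCA mule_ge0 ?lee_fin//.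
    exact: (nnfun_muleindic_ge0 (g n) y (V w)).
rewrite !key//; congr (limn _); apply/funext => n.
by apply: eq_fsbigr => y _; rewrite ab.
Qed.

End weighted.

Section others.
Context (d d' : measure_display) (Omega : measurableType d)
  (T : measurableType d') (R : realType) (P : probability Omega R).
Variable Z : nat -> Omega -> T.
Variables n k : nat.

(* A pi-system that generates the events of all observations before the n-th,
   the k-th excluded. *)
Definition others : set (set Omega) :=
  [set B | exists2 A : nat -> set T, forall i, measurable (A i) &
     B = \bigcap_(i in [set i | (i < n)%N && (i != k)]) Z i @^-1` A i].

Local Notation Omega_ := (g_sigma_algebraType others).

Lemma measurable_others j : (j < n)%N -> j != k ->
  measurable_fun setT (Z j : Omega_ -> T).
Proof.
move=> jn jk _ B mB; rewrite setTI; apply: sub_sigma_algebra.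
exists (fun i => if i == j then B else setT).
  by move=> i; case: ifP.
apply/seteqP; split => [w Bw i _ /=|w].
  by case: eqVneq => // ->.
by move/(_ j); rewrite /= jn jk eqxx => /(_ isT).
Qed.

Hypothesis mZ : forall i, measurable_fun setT (Z i).
Hypothesis indZ : mutually_independent P Z.

Lemma others_measurable : others `<=` measurable.
Proof.
move=> _ [A mA ->]; apply: bigcap_measurableType => i _.
by rewrite -[X in measurable X]setTI; exact: mZ.
Qed.

Lemma measurable_id_others : measurable_fun setT (id : Omega -> Omega_).
Proof.
move=> _ B mB; rewrite setTI preimage_id.
have : <<s others >> `<=` @measurable _ Omega.
  by apply: smallest_sub; [exact: sigma_algebra_measurable|exact: others_measurable].
exact.
Qed.

Lemma others_setI_closed : setI_closed others.
Proof.
move=> _ _ [A mA ->] [B mB ->]; exists (fun i => A i `&` B i).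
  by move=> i; exact: measurableI.
by rewrite -bigcapI.
Qed.

(** For fixed [A] both sides are finite measures in [B]; they agree on the generating pi-system,
    hence on the sigma-algebra. *)
Lemma independent_others (A : set T) (B : set Omega_) :
  measurable A -> measurable B ->
  (P (Z k @^-1` A `&` B) = P (Z k @^-1` A) * P B)%E.
Proof.
move=> mA mB.
have mZA : measurable (Z k @^-1` A).
  by rewrite -[X in measurable X]setTI; exact: mZ.
have finA : P (Z k @^-1` A) \is a fin_num by exact: fin_num_measure.
pose m1 : {measure set Omega -> \bar R} := mrestr P mZA.
have nnA : (0 <= fine (P (Z k @^-1` A)))%R by rewrite fine_ge0.
pose m2 : {measure set Omega -> \bar R} := mscale (NngNum nnA) P.
suff /(_ B mB) : forall C : set Omega, <<s others >> C -> m1 C = m2 C.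
  move=> mE; rewrite setIC; apply: (etrans mE).
  by congr (_ * _)%E; exact: fineK.
apply: (g_sigma_algebra_measure_unique others others_measurable (fun=> setT)) => //.
- move=> _; exists (fun=> setT) => //.
  by apply/esym/seteqP; split=> // w _ i _.
- by rewrite bigcup_const//; exists 0%N.
- exact: others_setI_closed.
- move=> _ [C mC ->]; rewrite /m1 /m2 /mrestr /mscale/=.
  pose s := [seq j <- iota 0 n | j != k].
  (* With [A] inserted at the index [k] the intersection becomes a rectangle over [k :: s];
     comparing independence over [k :: s] and over [s] isolates the factor of [Z k]. *)
  pose D j := if j == k then A else C j.
  have mD j : measurable (D j) by rewrite /D; case: ifP.
  have ks : k \notin s by rewrite mem_filter eqxx.
  have us : uniq s by rewrite filter_uniq// iota_uniq.
  have sE : [set` s] = [set i | (i < n)%N && (i != k)].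
    by apply/seteqP; split=> i /=; rewrite mem_filter mem_iota add0n andbC.
  have DC : \bigcap_(i in [set` s]) Z i @^-1` D i =
            \bigcap_(i in [set` s]) Z i @^-1` C i.
    apply: eq_bigcapr => i; rewrite /= mem_filter => /andP[ik _].
    by rewrite /D (negbTE ik).
  have Dk : D k = A by rewrite /D eqxx.
  have kus : uniq (k :: s) by rewrite /= ks.
  have := indZ kus mD; have := indZ us mD.
  rewrite DC -sE big_cons Dk => Es Eks.
  suff : (P (\bigcap_(i in [set` s]) Z i @^-1` C i `&` Z k @^-1` A) =
    (fine (P (Z k @^-1` A)))%:E * P (\bigcap_(i in [set` s]) Z i @^-1` C i))%E.
    by [].
  rewrite Es -EFinM -Eks.
  congr (P _); rewrite -DC; apply/seteqP; split => w.
    move=> [Dw Aw] i /=; rewrite in_cons => /predU1P[->|/Dw//].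
    by rewrite Dk.
  move=> Dw; split; last by rewrite -Dk; apply: Dw; rewrite /= mem_head.
  by move=> i /= si; apply: Dw; rewrite /= in_cons si orbT.
- move=> _; suff : (P (setT `&` Z k @^-1` A) < +oo)%E by [].
  by rewrite setTI (le_lt_trans (probability_le1 _ _)) ?ltry.
Qed.

(** Tonelli for the law of [(Z k, id)] on [T * Omega_]: the identity, seen as a map into the coarser
    space [Omega_], carries only what the other observations determine, so this law is a product.
    Keeping the sample point as second argument avoids introducing the vector of the other
    observations. *)
Lemma ge0_integral_others (f : T * Omega_ -> \bar R) :
  measurable_fun setT f -> (forall x, 0 <= f x)%E ->
  (\int[P]_w f (Z k w, w) = \int[P]_w \int[P]_v f (Z k v, w))%E.
Proof.
move=> mf f0.
have mpr : measurable_fun setT (fun w : Omega => ((Z k w, w) : T * Omega_)).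
  by apply: measurable_fun_pair; [exact: mZ|exact: measurable_id_others].
pose pr : {RV P >-> (T * Omega_)%type} := mfun_Sub (mem_set mpr).
pose Zk : {RV P >-> T} := mfun_Sub (mem_set (mZ k)).
pose id_ : {RV P >-> Omega_} := mfun_Sub (mem_set measurable_id_others).
have prE A : measurable A ->
    (distribution P Zk \x distribution P id_)%E A = distribution P pr A.
  apply: product_measure_unique => B C mB mC.
  exact: independent_others.
transitivity (\int[distribution P pr]_x f x)%E.
  by rewrite ge0_integral_distribution.
transitivity (\int[distribution P Zk \x distribution P id_]_x f x)%E.
  by apply: eq_measure_integral => A mA _; exact/esym/prE.
rewrite fubini_tonelli2// ge0_integral_distribution//; last 2 first.
- exact: measurable_fun_fubini_tonelli_G.
- by move=> y; exact: integral_ge0.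
apply: eq_integral => w _; rewrite /= /fubini_G ge0_integral_distribution//.
by apply: measurableT_comp => //; exact: measurable_pair2.
Qed.

Context d'' (U : measurableType d'') (psi : T -> U).
Hypothesis mpsi : measurable_fun setT psi.

(** Once the other observations are frozen, [h] is a function of [psi (Z k)] alone, and the
    conditional identity applies under the outer integral. *)
Lemma ge0_integral_others_weighted (a b : T -> R) (h : U * Omega_ -> R) :
  measurable_fun setT a -> (forall z, 0 <= a z) ->
  measurable_fun setT b -> (forall z, 0 <= b z) ->
  (forall B, measurable B ->
     \int[P]_(w in (fun w => psi (Z k w)) @^-1` B) (a (Z k w))%:E =
     \int[P]_(w in (fun w => psi (Z k w)) @^-1` B) (b (Z k w))%:E)%E ->
  measurable_fun setT h -> (forall x, 0 <= h x) ->
  (\int[P]_w (a (Z k w) * h (psi (Z k w), w))%:E =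
   \int[P]_w (b (Z k w) * h (psi (Z k w), w))%:E)%E.
Proof.
move=> ma a0 mb b0 ab mh h0.
have mf (c : T -> R) : measurable_fun setT c ->
    measurable_fun setT (fun x : T * Omega_ => (c x.1 * h (psi x.1, x.2))%:E).
  move=> mc; apply/measurable_EFinP/measurable_funM.
    exact: measurableT_comp.
  apply: measurableT_comp => //; apply: measurable_fun_pair => //.
  exact: measurableT_comp.
rewrite (@ge0_integral_others (fun x => (a x.1 * h (psi x.1, x.2))%:E))//; last 2 first.
- exact: mf.
- by move=> x; rewrite lee_fin mulr_ge0.
rewrite (@ge0_integral_others (fun x => (b x.1 * h (psi x.1, x.2))%:E))//; last 2 first.
- exact: mf.
- by move=> x; rewrite lee_fin mulr_ge0.
apply: eq_integral => w _ /=.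
apply: (@ge0_integral_weighted_eq _ _ _ _ _ P (fun w => psi (Z k w))
  (fun v => a (Z k v)) (fun v => b (Z k v)) (fun x => h (x, w))) => //.
all: try by apply: measurableT_comp.
have mp : measurable_fun setT (fun x : U => (x, w) : U * Omega_).
  by apply: measurable_fun_pair.
exact: (measurableT_comp mh mp).
Qed.

(** Both [e] and [h] are split by sign: the parts of [e] are nonnegative functions with the same
    integrals over preimages under [psi (Z k)], and the parts of [h] are admissible weights. *)
Lemma integral_others_centered (e : T -> R) (h : U * Omega_ -> R) :
  measurable_fun setT e -> P.-integrable setT (fun w => (e (Z k w))%:E) ->
  (forall B, measurable B ->
     \int[P]_(w in (fun w => psi (Z k w)) @^-1` B) (e (Z k w))%:E = 0)%E ->
  measurable_fun setT h ->
  P.-integrable setT (fun w => (e (Z k w) * h (psi (Z k w), w))%:E) ->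
  (\int[P]_w (e (Z k w) * h (psi (Z k w), w))%:E = 0)%E.
Proof.
move=> me ie e0 mh ieh.
have mh' : measurable_fun setT (fun w : Omega => h (psi (Z k w), w)).
  apply: (measurableT_comp mh); apply: measurable_fun_pair.
    exact: measurableT_comp.
  exact: measurable_id_others.
have meZ : measurable_fun setT (fun w => e (Z k w)) by exact: measurableT_comp.
have ab B : measurable B ->
    (\int[P]_(w in (fun w => psi (Z k w)) @^-1` B) (e^\+ (Z k w))%:E =
     \int[P]_(w in (fun w => psi (Z k w)) @^-1` B) (e^\- (Z k w))%:E)%E.
  move=> mB; set D := _ @^-1` B.
  have mD : measurable D.
    rewrite -[X in measurable X]setTI; apply: (measurableT_comp mpsi (mZ k)) => //.
  have ieD : P.-integrable D (fun w => (e (Z k w))%:E) by exact: integrableS ie.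
  exact: (eq_integral_funrpos_funrneg (f := e \o Z k) mD ieD (e0 B mB)).
have ge0case (g : U * Omega_ -> R) : measurable_fun setT g -> (forall x, 0 <= g x) ->
    P.-integrable setT (fun w => (e (Z k w) * g (psi (Z k w), w))%:E) ->
    (\int[P]_w (e (Z k w) * g (psi (Z k w), w))%:E = 0)%E.
  move=> mg g0 ieg.
  have := @ge0_integral_others_weighted e^\+ e^\- g (measurable_funrpos me)
    (funrpos_ge0 e) (measurable_funrneg me) (funrneg_ge0 e) ab mg g0.
  rewrite [X in _ -> X = _]integralE.
  set f := fun w => e (Z k w) * g (psi (Z k w), w).
  have -> : ((fun w => (f w)%:E)^\+ = fun w => (e^\+ (Z k w) * g (psi (Z k w), w))%:E)%E.
    rewrite -[LHS]/((EFin \o f)^\+)%E funerpos; apply/funext => w /=.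
    by rewrite /funrpos /f maxr_pMl// mul0r.
  have -> : ((fun w => (f w)%:E)^\- = fun w => (e^\- (Z k w) * g (psi (Z k w), w))%:E)%E.
    rewrite -[LHS]/((EFin \o f)^\-)%E funerneg; apply/funext => w /=.
    by rewrite /funrneg /f -mulNr maxr_pMl// mul0r.
  (* The equal integrals of the two parts cancel only because they are finite, which is where
     integrability of the product enters. *)
  move=> ->; rewrite subee//.
  have := integrable_fin_num measurableT (integrable_funrneg (f := f) measurableT ieg).
  congr (_ \is a fin_num); apply: eq_integral => w _ /=.
  by rewrite /funrneg /f -mulNr maxr_pMl// mul0r.
have ih (g : U * Omega_ -> R) : measurable_fun setT g -> (forall x, `|g x| <= `|h x|) ->
    P.-integrable setT (fun w => (e (Z k w) * g (psi (Z k w), w))%:E).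
  move=> mg gh; apply: (le_integrable measurableT _ _ ieh).
    apply/measurable_EFinP/measurable_funM => //.
    apply: (measurableT_comp mg); apply: measurable_fun_pair.
      exact: measurableT_comp.
    exact: measurable_id_others.
  by move=> w _; rewrite /= lee_fin !normrM ler_wpM2l.
have hp x : `|h^\+ x| <= `|h x|.
  by rewrite /funrpos ger0_norm ?le_max ?lexx ?orbT// ge_max ler_norm normr_ge0.
have hn x : `|h^\- x| <= `|h x|.
  by rewrite /funrneg ger0_norm ?le_max ?lexx ?orbT// ge_max -normrN ler_norm normr_ge0.
have ip := ih _ (measurable_funrpos mh) hp.
have im := ih _ (measurable_funrneg mh) hn.
transitivity (\int[P]_w ((e (Z k w) * h^\+ (psi (Z k w), w))%:E
                        - (e (Z k w) * h^\- (psi (Z k w), w))%:E))%E.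
  apply: eq_integral => w _; rewrite -EFinB -mulrBr.
  by rewrite -[in LHS](funrposBneg h).
rewrite integralB//.
rewrite !ge0case ?sube0//.
all: try exact: measurable_funrpos.
all: try exact: measurable_funrneg.
all: by [exact: funrpos_ge0 | exact: funrneg_ge0].
Qed.
End others.

(** * Kernels and small ball probabilities *)

Section unit_interval.
Context (R : realType).
Local Notation mu := (@lebesgue_measure R).
Implicit Types G H g h : R -> R.

(** The derivative is only integrable on the open interval: that of a kernel is continuous on
    [[0, 1)] but may be unbounded near 1. The class is stable under products, as [K^2] and [s K(s)]
    require. *)
Definition C1_unit_interval G g :=
  [/\ {within `[0, 1], continuous G},
      forall s : R, 0 < s < 1 -> is_derive s 1 G (g s),
      forall s : R, 0 < s < 1 -> {for s, continuous g}
    & mu.-integrable `]0, 1[ (EFin \o g)].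

Lemma integrable_itv_oo_cc g : mu.-integrable `]0, 1[ (EFin \o g) ->
  mu.-integrable `[0, 1] (EFin \o g).
Proof.
move=> /integrableP[mg ig]; apply/integrableP; split.
  exact: (emeasurable_fun_itv_cc mg).
by rewrite integral_itv_bndoo//; exact: measurableT_comp.
Qed.

Lemma eq_Rintegral_itv_oo g h : measurable_fun `](0 : R), 1[ h ->
  (forall s : R, 0 < s < 1 -> g s = h s) ->
  \int[mu]_(s in `[0, 1]) g s = \int[mu]_(s in `[0, 1]) h s.
Proof.
move=> mh gh; rewrite /Rintegral; congr fine.
have gh' : {in `]0, 1[%classic, h =1 g}.
  by move=> s; rewrite inE/= in_itv/= => /gh.
have mg : measurable_fun `](0 : R), 1[ g by exact: eq_measurable_fun mh.
rewrite (@integral_itv_bndoo _ _ _ (EFin \o g)); last exact/measurable_EFinP.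
rewrite (@integral_itv_bndoo _ _ _ (EFin \o h)); last exact/measurable_EFinP.
by apply: eq_integral => s /gh' /= ->.
Qed.

(** Since [g] may be discontinuous at the endpoints, the argument goes through the difference of the
    indefinite integral and [G]: it is continuous on [[s, 1]] with null derivative inside, hence
    constant by the mean value theorem. *)
Lemma C1_unit_interval_FTC G g (s : R) : C1_unit_interval G g -> 0 <= s <= 1 ->
  \int[mu]_(u in `[s, 1]) g u = G 1 - G s.
Proof.
move=> [cG dG cg ig] /andP[s0]; rewrite le_eqVlt => /predU1P[->|s1].
  by rewrite set_itv1 Rintegral_set1 subrr.
have ig01 := integrable_itv_oo_cc ig.
have igs : mu.-integrable `[s, 1] (EFin \o g).
  by apply: integrableS ig01 => //; apply: subset_itvr; rewrite bnd_simp.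
pose I (x : R) : R := \int[mu]_(u in `[s, x]) g u.
have cI : {within `[s, 1], continuous I}.
  exact: parameterized_integral_continuous (ltW s1) igs.
have cGs : {within `[s, 1], continuous G}.
  apply: continuous_subspaceW cG; apply: subset_itvr; by rewrite bnd_simp.
have dI x : x \in `]s, 1[ -> is_derive x 1 (I - G) (0 : R).
  rewrite in_itv/= => /andP[sx x1].
  have x01 : 0 < x < 1 by rewrite x1 (le_lt_trans s0 sx).
  have [dIx IxE] : derivable I x 1 /\ derive1 I x = g x.
    by apply: (@continuous_FTC1 _ g (BLeft s) x 1) => //; exact: cg.
  have dIx' : is_derive x 1 I (g x) 
    by apply: DeriveDef; [exact: dIx|rewrite -derive1E; exact: IxE].
  have dGx := dG x x01.
  by rewrite -(subrr (g x)); exact: is_deriveB.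
have cIG : {within `[s, 1], continuous (I - G)}.
  by move=> x; apply: cvgB; [exact: cI|exact: cGs].
have [c _] := MVT s1 dI cIG.
rewrite mul0r !fctE => eqI.
have Is0 : I s = 0 by rewrite /I set_itv1 Rintegral_set1.
by rewrite -[LHS]/(I 1); move: eqI; rewrite Is0; lra.
Qed.

Lemma continuous_unit_interval_bounded G : {within `[0, 1], continuous G} ->
  exists2 B, 0 <= B & forall s : R, 0 <= s <= 1 -> `|G s| <= B.
Proof.
move=> cG.
have cG' : {within `[0, 1], continuous (fun s => `|G s|)}.
  by move=> x; apply: cvg_norm; exact: cG.
have [c c01 cmax] := EVT_max ler01 cG'.
by exists `|G c| => // s s01; apply: cmax; rewrite in_itv.
Qed.

Lemma C1_unit_interval_measurable G g : C1_unit_interval G g ->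
  measurable_fun `[(0 : R), 1] G.
Proof. by move=> [cG _ _ _]; exact: subspace_continuous_measurable_fun. Qed.

(** A continuous factor is bounded on [[0, 1]], which keeps the derivative of the product
    integrable. *)
Lemma C1_unit_intervalM G g H h : C1_unit_interval G g -> C1_unit_interval H h ->
  C1_unit_interval (fun u => G u * H u) (fun u => G u * h u + H u * g u).
Proof.
move=> rG rH; have [cG dG cg ig] := rG; have [cH dH ch ih] := rH.
have bnd G1 g1 h1 : C1_unit_interval G1 g1 -> mu.-integrable `]0, 1[ (EFin \o h1) ->
    mu.-integrable `]0, 1[ (EFin \o (fun u => G1 u * h1 u)).
  move=> rG1 ih1; have [cG1 _ _ _] := rG1.
  have [B B0 GB] := continuous_unit_interval_bounded cG1.
  have mG1 : measurable_fun `](0 : R), 1[ G1.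
    apply: measurable_funS (C1_unit_interval_measurable rG1) => //.
    exact: subset_itv_oo_cc.
  apply: (le_integrable _ _ _ (integrableZl _ B ih1)) => //.
    apply/measurable_EFinP/measurable_funM => //.
    by apply/measurable_EFinP; case/integrableP : ih1.
  move=> x; rewrite /= in_itv/= => /andP[x0 x1].
  rewrite lee_fin !normrM ler_wpM2r// (ger0_norm B0).
  by apply: GB; rewrite !ltW.
split.
- by move=> x; apply: cvgM; [exact: cG|exact: cH].
- move=> s s01; have dGs := dG s s01; have dHs := dH s s01.
  exact: is_deriveM.
- move=> s s01; apply: cvgD; apply: cvgM.
  + apply/differentiable_continuous/derivable1_diffP.
    by have [] := dG s s01.
  + exact: ch.
  + apply/differentiable_continuous/derivable1_diffP.
    by have [] := dH s s01.
  + exact: cg.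
- have := integrableD _ (bnd _ _ _ rG ih) (bnd _ _ _ rH ig).
  exact.
Qed.

Lemma C1_unit_interval_id : C1_unit_interval id (fun=> 1).
Proof.
split.
- by apply: continuous_subspaceT => x; exact: cvg_id.
- by move=> s _; exact: is_derive_id.
- by move=> s _; exact: cvg_cst.
- apply: (@integrableS _ _ _ mu `[0, 1]) => //; first exact: subset_itv_oo_cc.
  apply: continuous_compact_integrable; first exact: segment_compact.
  by apply: continuous_subspaceT => x; exact: cvg_cst.
Qed.

(* The derivative may be unbounded near the endpoints; its sign makes it
   integrable. *)
Lemma C1_unit_interval_nonincreasing G g : {within `[0, 1], continuous G} ->
  (forall s : R, 0 < s < 1 -> is_derive s 1 G (g s)) ->
  (forall s : R, 0 < s < 1 -> {for s, continuous g}) ->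
  (forall s : R, 0 < s < 1 -> g s <= 0) ->
  C1_unit_interval G g.
Proof.
move=> cG dG cg g0; split => //.
have mg : measurable_fun `](0 : R), 1[ g.
  apply: open_continuous_measurable_fun; first exact: interval_open.
  by move=> x; rewrite inE/= in_itv/= => /cg.
(* The shift by 3 gives [a n <= 1 / 3], so that [a n < 1 - a n] for every [n]. *)
pose a n : R := n.+3%:R^-1.
pose F n := `[a n, 1 - a n]%classic.
have a0 n : 0 < a n by rewrite invr_gt0.
have a3 n : a n <= 3^-1 by rewrite lef_pV2 ?posrE// ler_nat.
have aN n : a n < 1 - a n by have := a3 n; lra.
have FT : \bigcup_n F n = `]0, 1[%classic.
  apply/seteqP; split => [x [n _]|x]; rewrite /F /= !in_itv/=.
    move=> /andP[x0 x1]; rewrite (lt_le_trans (a0 n) x0).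
    by apply: (le_lt_trans x1); rewrite ltrBlDr ltrDl.
  move=> /andP[x0 x1].
  have m0 : 0 < Num.min x (1 - x) by rewrite lt_min x0 subr_gt0.
  pose n := Num.truncn (Num.min x (1 - x))^-1.
  exists n => //; rewrite /F/= in_itv/=.
  have : a n <= Num.min x (1 - x).
    rewrite /a -[leRHS]invrK lef_pV2 ?posrE ?invr_gt0//.
    apply: ltW; apply: (lt_le_trans (truncnS_gt _)).
    by rewrite ler_nat -/n ltnW.
  by rewrite le_min => /andP[-> ?]; lra.
apply/integrableP; split; first exact/measurable_EFinP.
have subF n : F n `<=` `]0, 1[%classic by rewrite -FT; exact: bigcup_sup.
(* As [g <= 0], the integral of its absolute value is a difference of two values of [G], bounded
   uniformly in [n]. *)
have EN n : (\int[mu]_(x in F n) `|(g x)%:E| = (G (a n) - G (1 - a n))%:E)%E.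
  have := a0 n; have := aN n => an1 an0.
  have dF x : a n <= x <= 1 - a n -> 0 < x < 1.
    move=> /andP[x0 x1]; rewrite (lt_le_trans an0 x0).
    by apply: (le_lt_trans x1); rewrite ltrBlDr ltrDl.
  transitivity (\int[mu]_(x in F n) (- g x)%:E)%E.
    apply: eq_integral => x; rewrite inE /F /= in_itv/= => /dF x01.
    by rewrite ler0_norm// g0.
  have dNG x : x \in `](a n), (1 - a n)[ -> is_derive x 1 (- G) (- g x).
    rewrite in_itv/= => /andP[x0 x1]; have xa : a n <= x <= 1 - a n by rewrite !ltW.
    by have := dG x (dF x xa); exact: is_deriveN.
  have cGx x : 0 < x < 1 -> {for x, continuous (- G)}.
    move=> x01; have dGx := dG x x01.
    apply/differentiable_continuous/derivable1_diffP.
    by have [] := is_deriveN dGx.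
  rewrite (@continuous_FTC2 _ (- g) (- G)).
  - by rewrite -EFinB !fctE opprK addrC.
  - exact: an1.
  - apply: continuous_in_subspaceT => x; rewrite inE/= in_itv/= => xa.
    by apply: continuousN; apply: cg; exact: dF.
  - split.
    + by move=> x /dNG[].
    + by apply: cvg_at_right_filter; apply: cGx; apply: dF; rewrite lexx ltW.
    + by apply: cvg_at_left_filter; apply: cGx; apply: dF; rewrite lexx ltW.
  - by move=> x /dNG dNGx; rewrite derive1E derive_val.
have ndF : nondecreasing_seq F.
  move=> m n mn; apply/subsetPset => x; rewrite /F/= !in_itv/=.
  have amn : a n <= a m by rewrite lef_pV2 ?posrE// ler_nat !ltnS.
  by move=> /andP[? ?]; apply/andP; split; lra.
have cv : (\int[mu]_(x in F n) `|(g x)%:E|)%E @[n --> \oo] -->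
    (\int[mu]_(x in \bigcup_n F n) `|(g x)%:E|)%E.
  apply: ge0_nondecreasing_set_cvg_integral => //.
  - by move=> n; exact: measurable_itv.
  - move=> n; apply: measurableT_comp => //; apply/measurable_EFinP.
    exact: (measurable_funS _ (@subF n) mg).
have [B B0 GB] := continuous_unit_interval_bounded cG.
rewrite -FT -(cvg_lim _ cv)//; apply: (@le_lt_trans _ _ (B + B)%:E); last exact: ltry.
apply: lime_le; first by apply/cvg_ex; eexists; exact: cv.
apply: nearW => n; rewrite EN lee_fin.
have ab x : a n <= x <= 1 - a n -> `|G x| <= B.
  move=> /andP[x0 x1]; apply: GB; rewrite (le_trans (ltW (a0 n)) x0)/=.
  by rewrite (le_trans x1)// gerBl ltW.
apply: (le_trans (ler_norm _)); apply: (le_trans (ler_normB _ _)).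
by apply: lerD; apply: ab; rewrite lexx (ltW (aN n)).
Qed.

End unit_interval.

Section by_parts.
Context (R : realType) (d : measure_display) (Omega : measurableType d)
  (P : probability Omega R) (S : Omega -> R).
Local Notation mu := (@lebesgue_measure R).
Hypotheses (mS : measurable_fun setT S) (S0 : forall w, 0 <= S w).

Lemma measurable_sublevel t : measurable [set w | S w <= t].
Proof.
have := @measurable_fun_ler _ _ _ setT S (fun=> t) mS (measurable_cst _).
by move=> /(_ measurableT [set true] I); rewrite setTI.
Qed.

Variable t : R.
Hypothesis t0 : 0 < t.

Lemma C1_unit_interval_measurableT (G g : R -> R) : C1_unit_interval G g ->
  (forall s : R, ~~ (0 <= s <= 1) -> G s = 0) -> measurable_fun setT G.
Proof.
move=> rG G0; have := C1_unit_interval_measurable rG.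
move=> /(measurable_restrictT _ (measurable_itv _)); apply: eq_measurable_fun => s _.
by rewrite patchE; case: ifPn => //; rewrite notin_setE/= in_itv/= => /negP /G0.
Qed.

(* Fubini applied to [G 1 - G (S / t) = \int_(S / t <= u <= 1) g u] on the event
   [S <= t]. *)
Lemma expectation_by_parts (G g : R -> R) : C1_unit_interval G g ->
  (forall s : R, ~~ (0 <= s <= 1) -> G s = 0) ->
  \int[P]_w G (t^-1 * S w) =
  G 1 * fine (P [set w | S w <= t]) -
  \int[mu]_(u in `[0, 1]) (g u * fine (P [set w | S w <= t * u])).
Proof.
move=> rG G0; have [cG dG cg ig] := rG.
have ig01 := integrable_itv_oo_cc ig.
have mG := C1_unit_interval_measurableT rG G0.
have mGS : measurable_fun setT (fun w => G (t^-1 * S w)).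
  by apply: (measurableT_comp mG); exact: measurable_funM.
have [B B0 GB] := continuous_unit_interval_bounded cG.
have iGS : P.-integrable setT (EFin \o (fun w => G (t^-1 * S w))).
  apply: (@integrable_bounded _ _ _ P _ B mGS) => w.
  by have [/GB//|/G0->] := boolP (0 <= t^-1 * S w <= 1); rewrite normr0.
pose A := [set x : Omega * R | S x.1 <= t * x.2].
have mA : measurable A.
  have /(_ measurableT [set true] I) :
      measurable_fun setT (fun x : Omega * R => S x.1 <= t * x.2).
    apply: measurable_fun_ler; first exact: measurableT_comp.
    exact: measurable_funM.
  by rewrite setTI.
pose g01 := g \_ `[0, 1].
have ig01' : mu.-integrable setT (EFin \o g01).
  by rewrite -restrict_EFin; apply/integrable_restrict => //=; rewrite setTI.
have mg01 : measurable_fun setT g01.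
  by case/integrableP : ig01' => /measurable_EFinP.
pose k (x : Omega * R) : R := g01 x.2 * \1_A x.
have mk : measurable_fun setT k.
  by apply: measurable_funM; [exact: measurableT_comp|exact: measurable_indic].
(* If [S w > t], no [u <= 1] satisfies [S w <= t * u], and [G] vanishes as well; otherwise the
   section at [w] is the restriction of [g] to [[S w / t, 1]]. *)
have kE w : (\int[mu]_u (k (w, u))%:E =
    (G 1 * \1_[set w | S w <= t] w - G (t^-1 * S w))%:E)%E.
  have s0 : 0 <= t^-1 * S w by rewrite mulr_ge0// invr_ge0 ltW.
  have [s1|s1] := leP (t^-1 * S w) 1; last first.
    rewrite (G0 (t^-1 * S w)); last by rewrite s0/= -ltNge.
    rewrite indicE memNset ?mulr0 ?subrr/=; last first.
      by apply/negP; rewrite -ltNge; move: s1; rewrite mulrC ltr_pdivlMr// mul1r.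
    apply: integral0_eq => u _; rewrite /k /g01 patchE.
    case: ifPn => [|_]; last by rewrite mul0r.
    rewrite inE/= in_itv/= => /andP[u0 u1]; rewrite indicE memNset ?mulr0//=.
    apply/negP; rewrite -ltNge; move: s1; rewrite mulrC ltr_pdivlMr// mul1r.
    by apply: le_lt_trans; rewrite ler_piMr// ltW.
  rewrite indicE mem_set/= ?mulr1; last by move: s1; rewrite mulrC ler_pdivrMr// mul1r.
  rewrite -(C1_unit_interval_FTC rG); last by rewrite s0.
  have igs : mu.-integrable `[t^-1 * S w, 1] (EFin \o g).
    by apply: integrableS ig01 => //; apply: subset_itvr; rewrite bnd_simp.
  rewrite /Rintegral fineK; last exact: integrable_fin_num.
  rewrite [RHS]integral_mkcond; apply: eq_integral => u _.
  rewrite /k /g01 restrict_EFin/= !patchE indicE.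
  have -> : ((w, u) \in A) = (t^-1 * S w <= u).
    by rewrite mulrC ler_pdivrMr// (mulrC u); apply/idP/idP; rewrite inE.
  rewrite !mem_setE !in_itv/=.
  have [su|us] := leP (t^-1 * S w) u; last by rewrite mulr0 andFb.
  by rewrite (le_trans s0 su)/=; case: ifP; rewrite ?mul0r// mulr1.
have kE2 u : (\int[P]_w (k (w, u))%:E =
    (g01 u * fine (P [set w | S w <= t * u]))%:E)%E.
  have mAu : measurable [set w | S w <= t * u] by exact: measurable_sublevel.
  transitivity (\int[P]_w ((g01 u)%:E * (\1_[set w | S w <= t * u] w)%:E))%E.
    by apply: eq_integral => w _; rewrite -EFinM.
  rewrite integralZl//; last exact: integrable_indicator.
  by rewrite integral_indic// setIT EFinM fineK//; exact: fin_num_measure.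
have ik : (P \x mu)%E.-integrable setT (EFin \o k).
  apply/integrable21ltyP; first exact/measurable_EFinP.
  case/integrableP : ig01' => _; apply: le_lt_trans; apply: ge0_le_integral => //.
  - by move=> u _; exact: integral_ge0.
  - apply: (measurable_fun_fubini_tonelli_G (abse \o (EFin \o k))).
    + by apply: measurableT_comp => //; exact/measurable_EFinP.
    + by move=> x; exact: abse_ge0.
  - by apply: measurableT_comp => //; exact/measurable_EFinP.
  - move=> u _; apply: (@le_trans _ _ (\int[P]_w (cst `|g01 u|%:E) w)%E).
      apply: ge0_le_integral => //.
      + apply: measurableT_comp => //; apply/measurable_EFinP.
        have mp : measurable_fun setT (fun w : Omega => (w, u)).
          exact: measurable_fun_pair.
        exact: (measurableT_comp mk mp).
      + move=> w _; rewrite /= lee_fin /k normrM/= ler_piMr// indicE ger0_norm//.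
        by case: (_ \in _).
    rewrite integral_cst//; have /= -> := @probability_setT _ _ _ P.
    by rewrite mule1.
have FE := @Fubini _ _ _ _ _ P mu _ ik.
have lhs : (\int[P]_w (G 1 * \1_[set w | S w <= t] w - G (t^-1 * S w)) =
    G 1 * fine (P [set w | S w <= t]) - \int[P]_w G (t^-1 * S w))%R.
  have mA1 := measurable_sublevel t.
  rewrite RintegralB//; last exact/integrable_scale/integrable_indicator.
  by rewrite RintegralZl ?Rintegral_indic//; exact/integrable_indicator.
have rhs : (\int[mu]_(u in `[0, 1]) (g u * fine (P [set w | S w <= t * u])) =
    fine (\int[mu]_u \int[P]_w (k (w, u))%:E)%E)%R.
  rewrite Rintegral_mkcond /Rintegral; congr fine.
  apply: eq_integral => u _; rewrite kE2 /g01 !patchE.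
  by case: ifPn => _ //; rewrite mul0r.
have FE' : (\int[mu]_u \int[P]_w (k (w, u))%:E =
    \int[P]_w \int[mu]_u (k (w, u))%:E)%E by exact/esym/FE.
rewrite rhs FE'.
under eq_integral do rewrite kE.
by move: lhs; rewrite /Rintegral => ->; rewrite opprB addrC subrK.
Qed.
End by_parts.

Section kernel.
Context (R : realType).
Local Notation mu := (@lebesgue_measure R).
Variable K : R -> R.
Hypothesis hK : admissible_kernel K.

Lemma has_derivative_within_is_derive (f : R -> R) (s l : R) : 0 < s < 1 ->
  has_derivative_within `[0, 1[ f s l -> is_derive s 1 f l.
Proof.
move=> /andP[s0 s1] fl.
have fl' : h^-1 *: (f (h *: 1 + s) - f s) @[h --> (0 : R)^'] --> l.
  apply/cvgrPdist_lt => e e0.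
  move/cvgrPdist_lt : fl => /(_ e e0) /nbhs_ballP[r /= r0 rl].
  (* Within this radius the moved point stays in [[0, 1[], so the restriction to that set imposes
     nothing. *)
  apply/nbhs_ballP; exists (Num.min r (Num.min s (1 - s))).
    by rewrite /= !lt_min r0 s0 subr_gt0.
  move=> x; rewrite -ball_normE /= sub0r normrN !lt_min => /and3P[xr xs xs1] x0.
  have := rl (x + s).
  rewrite -ball_normE /= opprD addrCA subrr addr0 normrN => /(_ xr).
  have -> : x + s != s by rewrite -subr_eq0 addrK.
  move=> /(_ isT) H.
  have : `[0, 1[%classic (x + s).
    rewrite /= in_itv/=; move: xs xs1; rewrite !ltr_norml => /andP[? ?] /andP[? ?].
    by apply/andP; split; lra.
  move=> /H; rewrite addrK.
  by rewrite [x *: 1]mulr1 [_ *: _]mulrC.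
have df : derivable f s 1 by apply/cvg_ex; exists l; exact: fl'.
by apply: DeriveDef => //; apply/cvg_lim => //; exact: fl'.
Qed.

Lemma admissible_kernelE : exists2 K' : R -> R, C1_unit_interval K K' &
  forall s : R, 0 < s < 1 -> K' s <= 0.
Proof.
have [K0 cK [K' [dK cK' K'0]] K1] := hK.
have K'0' (s : R) : 0 < s < 1 -> K' s <= 0 by move=> /andP[s0 s1]; apply: K'0; rewrite ltW.
exists K' => //.
apply: C1_unit_interval_nonincreasing => //.
  move=> s s01; apply: has_derivative_within_is_derive => //; apply: dK.
  by case/andP : s01 => s0 s1; rewrite ltW.
have cK'o : {within `]0, 1[, continuous K'}.
  apply: continuous_subspaceW cK'; by apply: subset_itvr; rewrite bnd_simp.
move=> s s01; move: cK'o; rewrite continuous_open_subspace; last exact: interval_open.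
by apply; rewrite inE/= in_itv.
Qed.

(** The sign of the derivative makes [K] nonincreasing on [[0, 1]]. With [K 1 > 0], the kernel is
    thus comparable to the indicator of its support, and the total weight to the number of
    observations in the ball. *)
Lemma admissible_kernel_range s : 0 <= s <= 1 -> K 1 <= K s <= K 0.
Proof.
have [_ cK _ _] := hK; have [K' [_ dK _ _] K'0] := admissible_kernelE.
have dK1 x : x \in `]0, 1[%R -> derivable K x 1 by rewrite in_itv => /dK[].
have K'0' x : x \in `]0, 1[%R -> derive1 K x <= 0.
  by rewrite in_itv => x01; have [_ dKx] := dK x x01; rewrite derive1E dKx K'0.
move=> /andP[s0 s1].
by rewrite !(ler0_derive1_nincr dK1 K'0' cK).
Qed.

Lemma admissible_kernel_ge0 s : 0 <= K s.
Proof.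
have [K0 _ _ K1] := hK.
have [/admissible_kernel_range/andP[+ _]|/K0->//] := boolP (0 <= s <= 1).
by apply: le_trans; exact: ltW.
Qed.

Lemma admissible_kernel_le s : K s <= K 0.
Proof.
have [K0 _ _ K1] := hK.
have [/admissible_kernel_range/andP[]//|/K0->] := boolP (0 <= s <= 1).
exact: admissible_kernel_ge0.
Qed.

Lemma measurable_admissible_kernel : measurable_fun setT K.
Proof.
have [K0 _ _ _] := hK; have [K' rK _] := admissible_kernelE.
exact: (C1_unit_interval_measurableT rK).
Qed.

End kernel.

Section moments.
Context (R : realType) (d : measure_display) (Omega : measurableType d)
  (P : probability Omega R) (S : Omega -> R).
Local Notation mu := (@lebesgue_measure R).
Hypotheses (mS : measurable_fun setT S) (S0 : forall w, 0 <= S w).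
Let F t := fine (P [set w | S w <= t]).
Variables (h : nat -> R) (tau0 : R -> R).
Hypotheses (h_gt0 : forall n, 0 < h n) (h_cvg0 : h n @[n --> \oo] --> (0 : R)).
Hypothesis htau : forall s, 0 <= s <= 1 -> tau F t s @[t --> 0^'+] --> tau0 s.

Lemma sublevel_ge0 t : 0 <= F t.
Proof. by rewrite fine_ge0. Qed.

Lemma sublevel_nondecreasing : nondecreasing_fun F.
Proof.
move=> s t st; apply: fine_le; rewrite ?fin_num_measure//; try exact: measurable_sublevel.
apply: le_measure; rewrite ?inE; try exact: measurable_sublevel.
by move=> w /= /le_trans; apply.
Qed.

Lemma tau_cvg s : 0 <= s <= 1 -> tau F (h n) s @[n --> \oo] --> tau0 s.
Proof.
move=> /htau; apply: cvg_trans => A; rewrite /= => -[/= e e0 Ae].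
have := h_cvg0; move/cvgrPdist_lt => /(_ e e0); rewrite !nearE.
apply: filterS => n /= hne; apply: Ae => //=.
Qed.

Lemma measurable_sublevel_scaled (t : R) : measurable_fun setT (fun u : R => F (t * u)).
Proof.
apply: (measurableT_comp (f := F)); last exact: measurable_funM.
exact: nondecreasing_measurable sublevel_nondecreasing.
Qed.

Lemma measurable_tau t : measurable_fun setT (tau F t).
Proof.
by apply: measurable_funM => //; exact: measurable_sublevel_scaled.
Qed.

(** The limit function is given by pointwise convergence alone; its measurability is inherited from
    the functions [tau F (h n)]. *)
Lemma measurable_tau0 : measurable_fun `[(0 : R), 1] tau0.
Proof.
apply: (measurable_fun_cvg (h := fun n => tau F (h n))) => [n|s].
  exact: measurable_funS (measurable_tau (h n)).
by rewrite /= in_itv; exact: tau_cvg.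
Qed.

Lemma normr_tau t s : 0 < t -> s <= 1 -> `|tau F t s| <= 1.
Proof.
move=> t0 s1; have Fts : F (t * s) <= F t.
  by apply: sublevel_nondecreasing; rewrite ler_piMr// ltW.
rewrite /tau ger0_norm ?divr_ge0 ?sublevel_ge0//.
(* If [F t = 0] the quotient is 0, as [0^-1 = 0]. *)
have := sublevel_ge0 t; rewrite le_eqVlt => /predU1P[<-|Ft0].
  by rewrite invr0 mulr0.
by rewrite ler_pdivrMr// mul1r.
Qed.

(** Division of the integration by parts by [F (h n)] turns the probability of [S <= h n * u] into
    [tau], which is at most 1 on [[0, 1]], so [|g|] is a dominating function. A general [G] covers
    the three moments at once. *)
Lemma kernel_moment_cvg (G g : R -> R) : C1_unit_interval G g ->
  (forall s : R, ~~ (0 <= s <= 1) -> G s = 0) ->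
  (\forall n \near \oo, 0 < F (h n)) ->
  (\int[P]_w G ((h n)^-1 * S w)) / F (h n) @[n --> \oo] -->
  G 1 - \int[mu]_(u in `[0, 1]) (g u * tau0 u).
Proof.
move=> rG G0 Fpos; have [_ _ _ /integrable_itv_oo_cc ig] := rG.
have mg : measurable_fun `[(0 : R), 1] g.
  by case/integrableP : ig => /measurable_EFinP.
have cvI : \int[mu]_(u in `[0, 1]) (g u * tau F (h n) u) @[n --> \oo] -->
    \int[mu]_(u in `[0, 1]) (g u * tau0 u).
  have [] := @dominated_convergence _ _ _ mu `[0, 1] (measurable_itv _)
    (fun n u => (g u * tau F (h n) u)%:E) (fun u => (g u * tau0 u)%:E)
    (fun u => `|g u|%:E).
  - move=> n; apply/measurable_EFinP/measurable_funM => //.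
    exact: measurable_funS (measurable_tau (h n)).
  - by apply/measurable_EFinP/measurable_funM => //; exact: measurable_tau0.
  - apply: aeW => u; rewrite /= in_itv/= => u01.
    apply: cvg_EFin; first by apply: nearW.
    by apply: cvgM; [exact: cvg_cst|exact: tau_cvg].
  - exact: integrable_norm.
  - apply: aeW => u n; rewrite /= in_itv/= => /andP[u0 u1].
    by rewrite lee_fin normrM ler_piMr// normr_tau.
  move=> i1 _ cv; apply: fine_cvg; rewrite fineK; first exact: cv.
  exact: integrable_fin_num.
have cvG : G 1 - \int[mu]_(u in `[0, 1]) (g u * tau F (h n) u) @[n --> \oo] -->
    G 1 - \int[mu]_(u in `[0, 1]) (g u * tau0 u).
  by apply: cvgB => //; exact: cvg_cst.
apply: cvg_trans cvG; apply: near_eq_cvg; near=> n.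
have Fn : 0 < F (h n) by near: n.
rewrite (expectation_by_parts P mS S0 (h_gt0 n) rG G0) mulrBl.
rewrite -mulrA divff ?gt_eqF// mulr1; congr (_ - _).
rewrite -RintegralZr//; last first.
  apply: (le_integrable _ _ _ ig) => //.
    apply/measurable_EFinP/measurable_funM => //.
    exact: measurable_funS (measurable_sublevel_scaled (h n)).
  move=> u _; rewrite /= lee_fin normrM ler_piMr// ger0_norm ?fine_ge0//.
  by rewrite -lee_fin fineK ?probability_le1 ?fin_num_measure//; exact: measurable_sublevel.
by apply: eq_Rintegral => u _; rewrite /tau mulrA.
Unshelve. all: by end_near. Qed.

End moments.

(** With [0^-1 = 0] the inverse is total and fails to be continuous only at 0, a measurable
    singleton. *)
Lemma measurable_invr (R : realType) : measurable_fun setT (@GRing.inv R).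
Proof.
have -> : setT = [set x : R | x != 0] `|` [set 0].
  by apply/seteqP; split => x //= _; case: (eqVneq x 0); [right|left].
have op : open [set x : R | x != 0] by exact: open_neq.
apply/measurable_funU => //; first exact: open_measurable.
split; last exact: measurable_fun_set1.
apply: open_continuous_measurable_fun => // x; rewrite inE/= => x0.
exact: inv_continuous.
Qed.

(** * Sums, products and weights over an i.i.d. sample *)

Section sample.
Context (d d' d'' : measure_display) (Omega : measurableType d)
  (T : measurableType d') (U : measurableType d'') (R : realType)
  (P : probability Omega R).
Variables (Z : nat -> Omega -> T) (Z0 : Omega -> T).
Hypothesis hiid : iid_copies P Z Z0.

Let mZ0 : measurable_fun setT Z0. Proof. by have [] := hiid. Qed.
Let mZ i : measurable_fun setT (Z i). Proof. by have [] := hiid. Qed.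
Let indZ : mutually_independent P Z. Proof. by have [] := hiid. Qed.

Lemma ge0_integral_iid (f : T -> R) i : measurable_fun setT f ->
  (forall z, 0 <= f z) ->
  (\int[P]_w (f (Z i w))%:E = \int[P]_w (f (Z0 w))%:E)%E.
Proof.
move=> mf f0; have [_ _ eqd _] := hiid.
pose Zi : {RV P >-> T} := mfun_Sub (mem_set (mZ i)).
pose Z0' : {RV P >-> T} := mfun_Sub (mem_set mZ0).
have mfE : measurable_fun [set: T] (fun z => (f z)%:E) by exact/measurable_EFinP.
transitivity (\int[distribution P Zi]_z (f z)%:E)%E.
  by rewrite ge0_integral_distribution// => z; rewrite lee_fin.
transitivity (\int[distribution P Z0']_z (f z)%:E)%E; last first.
  by rewrite ge0_integral_distribution// => z; rewrite lee_fin.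
by apply: eq_measure_integral => A mA _; exact: eqd.
Qed.

Lemma Rintegral_iid (f : T -> R) i : measurable_fun setT f ->
  \int[P]_w f (Z i w) = \int[P]_w f (Z0 w).
Proof.
move=> mf; rewrite /Rintegral; congr fine; rewrite integralE [RHS]integralE.
congr (_ - _)%E.
  have fE V : ((fun w => (f (V w))%:E)^\+ = fun w : Omega => (f^\+ (V w))%:E)%E.
    by rewrite -[LHS]/((EFin \o (f \o V))^\+)%E funerpos.
  rewrite !fE; apply: (ge0_integral_iid (f := f^\+)).
    exact: measurable_funrpos.
  exact: funrpos_ge0.
have fE V : ((fun w => (f (V w))%:E)^\- = fun w : Omega => (f^\- (V w))%:E)%E.
  by rewrite -[LHS]/((EFin \o (f \o V))^\-)%E funerneg.
rewrite !fE; apply: (ge0_integral_iid (f := f^\-)).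
  exact: measurable_funrneg.
exact: funrneg_ge0.
Qed.

(** Applied to an exponential, this gives the Laplace transform of the total weight. The last factor
    is split off by Tonelli, the first [n] being measurable with respect to the others. *)
Lemma integral_prod_iid (g : T -> R) n : measurable_fun setT g ->
  (forall z, 0 <= g z) -> P.-integrable setT (EFin \o (fun w => g (Z0 w))) ->
  (\int[P]_w (\prod_(k < n) g (Z k w))%:E = ((\int[P]_w g (Z0 w)) ^+ n)%:E)%E.
Proof.
move=> mg g0 ig; have gE := EFin_Rintegral ig; elim: n => [|n IHn].
  under eq_integral do rewrite big_ord0.
  by rewrite -[LHS]/((\int[P]_w (cst 1%:E) w)%E) EFin_Rintegral ?Rintegral_prob_cst//;
    exact: (@finite_measure_integrable_cst _ _ _ P).
pose Omega_ := g_sigma_algebraType (others Z n.+1 n).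
pose f (x : T * Omega_) : \bar R := (g x.1 * \prod_(k < n) g (Z k x.2))%:E.
have mprod : measurable_fun setT (fun w : Omega_ => \prod_(k < n) g (Z k w)).
  apply: (measurable_prod (s := index_enum _)) => k _; apply: (measurableT_comp mg).
  apply: (@measurable_others _ _ _ _ Z n.+1 n k).
    by rewrite ltnS ltnW.
  by rewrite neq_ltn ltn_ord.
have mf : measurable_fun setT f.
  apply/measurable_EFinP/measurable_funM; first exact: measurableT_comp.
  exact: (measurableT_comp mprod measurable_snd).
have f0 x : (0 <= f x)%E by rewrite lee_fin mulr_ge0// prodr_ge0.
transitivity (\int[P]_w f (Z n w, w))%E.
  by apply: eq_integral => w _; rewrite /f/= big_ord_recr/= mulrC.
rewrite ge0_integral_others// /f/=.
transitivity (\int[P]_w ((\int[P]_w g (Z0 w))%:E * (\prod_(k < n) g (Z k w))%:E))%E.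
  apply: eq_integral => w _; under eq_integral do rewrite EFinM.
  rewrite ge0_integralZr//.
  - by rewrite ge0_integral_iid// gE.
  - by apply/measurable_EFinP; exact: measurableT_comp.
  - by move=> v _; rewrite lee_fin.
  - by rewrite lee_fin prodr_ge0.
rewrite ge0_integralZl//.
- by rewrite IHn -EFinM exprS.
- apply/measurable_EFinP; apply: (measurable_prod (s := index_enum _)) => k _.
  exact: measurableT_comp.
- by move=> w _; rewrite lee_fin prodr_ge0.
- by rewrite lee_fin Rintegral_ge0.
Qed.

End sample.

Section orthogonal.
Context (R : realType) (d : measure_display) (Omega : measurableType d)
  (P : probability Omega R).

Lemma integrable_mul_sqr (u v : Omega -> R) :
  measurable_fun setT u -> measurable_fun setT v ->
  P.-integrable setT (EFin \o (fun w => u w ^+ 2)) ->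
  P.-integrable setT (EFin \o (fun w => v w ^+ 2)) ->
  P.-integrable setT (EFin \o (fun w => u w * v w)).
Proof.
move=> mu mv iu iv.
apply: (@integrable_dominated _ _ _ P _ (fun w => u w ^+ 2 + v w ^+ 2)).
- exact: measurable_funM.
- move=> w; rewrite normrM -(real_normK (num_real (u w))) -(real_normK (num_real (v w))).
  move: `|u w| `|v w| => a b.
  have := sqr_ge0 (a - b); have := sqr_ge0 a; have := sqr_ge0 b; nra.
- exact: integrable_add.
Qed.

(** Pythagoras, shared by the i.i.d. centered sums and by the weighted noise, whose summands are
    orthogonal without being independent. *)
Lemma sqr_sum_orthogonal n (u : 'I_n -> Omega -> R) :
  (forall k, measurable_fun setT (u k)) ->
  (forall k, P.-integrable setT (EFin \o (fun w => u k w ^+ 2))) ->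
  (forall k l, k != l -> \int[P]_w (u k w * u l w) = 0) ->
  P.-integrable setT (EFin \o (fun w => (\sum_(k < n) u k w) ^+ 2)) /\
  \int[P]_w ((\sum_(k < n) u k w) ^+ 2) = \sum_(k < n) \int[P]_w (u k w ^+ 2).
Proof.
move=> mu iu u0.
have iuu k l : P.-integrable setT (EFin \o (fun w => u k w * u l w)).
  exact: integrable_mul_sqr.
have -> : (fun w => (\sum_(k < n) u k w) ^+ 2) =
    (fun w => \sum_(k < n) \sum_(l < n) u k w * u l w).
  by apply/funext => w; rewrite expr2 big_distrlr.
have iul k : P.-integrable setT (EFin \o (fun w => \sum_(l < n) u k w * u l w)).
  exact: integrable_sumr.
split; first exact: integrable_sumr.
rewrite Rintegral_sum//; apply: eq_bigr => k _.
rewrite Rintegral_sum// (bigD1 k)//= big1 ?addr0; last by move=> l lk; rewrite u0// eq_sym.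
by apply: eq_Rintegral => w _; rewrite expr2.
Qed.

End orthogonal.

Section weights.
Context (d d' d'' : measure_display) (Omega : measurableType d)
  (T : measurableType d') (U : measurableType d'') (R : realType)
  (P : probability Omega R).
Variables (Z : nat -> Omega -> T) (Z0 : Omega -> T).
Hypothesis hiid : iid_copies P Z Z0.

Let mZ0 : measurable_fun setT Z0. Proof. by have [] := hiid. Qed.
Let mZ i : measurable_fun setT (Z i). Proof. by have [] := hiid. Qed.
Let indZ : mutually_independent P Z. Proof. by have [] := hiid. Qed.

Lemma sqr_sum_iid_centered (f : T -> R) (B : R) n : measurable_fun setT f ->
  (forall z, `|f z| <= B) -> \int[P]_w f (Z0 w) = 0 ->
  P.-integrable setT (EFin \o (fun w => (\sum_(k < n) f (Z k w)) ^+ 2)) /\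
  \int[P]_w ((\sum_(k < n) f (Z k w)) ^+ 2) =
    n%:R * \int[P]_w (f (Z0 w) ^+ 2).
Proof.
move=> mf fB f0.
have mfZ k : measurable_fun setT (fun w => f (Z k w)) by exact: measurableT_comp.
have ifZ k : P.-integrable setT (EFin \o (fun w => f (Z k w))).
  exact: (@integrable_bounded _ _ _ P _ B).
have [||k l kl|i ->] := @sqr_sum_orthogonal _ _ _ P n (fun k w => f (Z k w)).
- by move=> k; exact: mfZ.
- move=> k; apply: (@integrable_bounded _ _ _ P _ (B ^+ 2)).
    by apply: measurable_funX; exact: mfZ.
  by move=> w; rewrite normrX lerXn2r ?nnegrE// (le_trans _ (fB (Z k w))).
- have mfl : measurable_fun setT
      ((fun w => f (Z l w)) : g_sigma_algebraType (others Z n k) -> R).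
    apply: (measurableT_comp mf); apply: measurable_others => //.
    by rewrite eq_sym.
  (* Plain centering is centering given a constant: [psi] is the constant map, under which every
     preimage is empty or the whole space. *)
  have ce := @integral_others_centered _ _ _ T _ P Z n k mZ indZ _ T
    (fun=> point) (measurable_cst _) f (fun x => f (Z l x.2)) mf (ifZ k).
  rewrite /Rintegral ce//.
  + move=> C mC; have [Cp|Cp] := pselect (C point).
      rewrite (_ : _ @^-1` _ = setT); last by apply/seteqP; split.
      have := @Rintegral_iid _ _ _ _ _ P Z Z0 hiid f k mf; rewrite f0.
      by rewrite EFin_Rintegral// => ->.
    rewrite (_ : _ @^-1` _ = set0); first by rewrite integral_set0.
    by apply/seteqP; split.
  + exact: (measurableT_comp mfl measurable_snd).
  + apply: (@integrable_bounded _ _ _ P _ (B ^+ 2)); first exact: measurable_funM.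
    by move=> w; rewrite normrM expr2 ler_pM.
- split => //; transitivity (\sum_(k < n) \int[P]_w (f (Z0 w) ^+ 2)).
    apply: eq_bigr => k _.
    exact: (Rintegral_iid hiid (f := fun z => f z ^+ 2) k (measurable_funX _ mf)).
  by rewrite sumr_const card_ord mulr_natl.
Qed.


Variables (psi : T -> U) (e : T -> R) (kap sig : U -> R).
Hypotheses (mpsi : measurable_fun setT psi) (me : measurable_fun setT e).
Hypotheses (mkap : measurable_fun setT kap) (kap0 : forall u, 0 <= kap u).
Hypotheses (msig : measurable_fun setT sig) (sig0 : forall u, 0 <= sig u).
Hypothesis ie : forall k, P.-integrable setT (EFin \o (fun w => e (Z k w))).
Hypothesis e0 : forall k B, measurable B ->
  (\int[P]_(w in (fun w => psi (Z k w)) @^-1` B) (e (Z k w))%:E = 0)%E.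
Hypothesis e2 : forall k B, measurable B ->
  (\int[P]_(w in (fun w => psi (Z k w)) @^-1` B) (e (Z k w) ^+ 2)%:E =
   \int[P]_(w in (fun w => psi (Z k w)) @^-1` B) (sig (psi (Z k w)))%:E)%E.
Variable C : R.
Hypotheses (C0 : 0 <= C) (sigC : forall u, sig u * kap u <= C * kap u).
Variable n : nat.

Definition total_weight w := \sum_(k < n) kap (psi (Z k w)).

Definition weight (k : nat) w := kap (psi (Z k w)) / total_weight w.

Lemma total_weight_ge0 w : 0 <= total_weight w.
Proof. by rewrite sumr_ge0. Qed.

Lemma weight_ge0 k w : 0 <= weight k w.
Proof. by rewrite divr_ge0// total_weight_ge0. Qed.

Lemma weight_le1 (k : 'I_n) w : weight k w <= 1.
Proof.
have := total_weight_ge0 w; rewrite /weight le_eqVlt => /predU1P[<-|S0].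
  by rewrite invr0 mulr0.
rewrite ler_pdivrMr// mul1r /total_weight (bigD1 k)//= lerDl.
by rewrite sumr_ge0.
Qed.

Lemma measurable_kap k : measurable_fun setT (fun w => kap (psi (Z k w))).
Proof. by apply: (measurableT_comp mkap); exact: measurableT_comp. Qed.

Lemma measurable_total_weight : measurable_fun setT total_weight.
Proof.
by rewrite /total_weight; apply: measurable_sum => k; exact: measurable_kap.
Qed.

Lemma measurable_weight k : measurable_fun setT (weight k).
Proof.
apply: measurable_funM; first exact: measurable_kap.
by apply: (measurableT_comp (@measurable_invr R)); exact: measurable_total_weight.
Qed.

Local Notation others_type k := (g_sigma_algebraType (others Z n k)).

(* [weight k] depends on the k-th observation and, through [rest k], on the
   others, so [share k] separates the two independent arguments. *)
Let rest (k : 'I_n) w := \sum_(j < n | j != k) kap (psi (Z j w)).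

Let totalE (k : 'I_n) w : total_weight w = kap (psi (Z k w)) + rest k w.
Proof. by rewrite /total_weight (bigD1 k). Qed.

Let mrest (k : 'I_n) : measurable_fun setT (rest k : others_type k -> R).
Proof.
rewrite /rest; under eq_fun do rewrite big_mkcond/=.
apply: measurable_sum => j; case: (boolP (j != k)) => jk; last exact: measurable_cst.
apply: (measurableT_comp mkap); apply: (measurableT_comp mpsi).
exact: measurable_others.
Qed.

Let share (k : 'I_n) (x : U * others_type k) := kap x.1 / (kap x.1 + rest k x.2).

Let mshare (k : 'I_n) : measurable_fun setT (@share k).
Proof.
apply: measurable_funM; first exact: (measurableT_comp mkap measurable_fst).
apply: (measurableT_comp (@measurable_invr R)); apply: measurable_funD.
  exact: (measurableT_comp mkap measurable_fst).
exact: (measurableT_comp (@mrest k) measurable_snd).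
Qed.

Let shareE (k : 'I_n) w : share (psi (Z k w), w : others_type k) = weight k w.
Proof. by rewrite /share /weight (totalE k). Qed.

Let meZ k : measurable_fun setT (fun w => e (Z k w)).
Proof. exact: measurableT_comp. Qed.

Let noise (k : 'I_n) w := e (Z k w) * weight k w.

Let mnoise k : measurable_fun setT (noise k).
Proof. by apply: measurable_funM => //; exact: measurable_weight. Qed.

Lemma integrable_noise (k : 'I_n) :
  P.-integrable setT (EFin \o (fun w => e (Z k w) * weight k w)).
Proof.
apply: (integrable_dominated (@mnoise k) (g := fun w => `|e (Z k w)|)).
  move=> w; rewrite normrM ler_piMr// ger0_norm ?weight_ge0//.
  exact: weight_le1.
exact: integrable_norm (ie k).
Qed.

Lemma Rintegral_noise (k : 'I_n) : \int[P]_w (e (Z k w) * weight k w) = 0.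
Proof.
have := @integral_others_centered _ _ _ T _ P Z n k mZ indZ _ U psi mpsi e
  (@share k) me (ie k) (e0 k) (@mshare k).
have -> : (fun w => (e (Z k w) * share (psi (Z k w), w : others_type k))%:E) =
    EFin \o (fun w => e (Z k w) * weight k w).
  by apply/funext => w; rewrite shareE.
by rewrite /Rintegral => ->//; exact: integrable_noise.
Qed.

(** The bound on [sig] holds only where [kap] does not vanish; a factor [kap] of the weight absorbs
    this restriction. *)
Lemma sig_weight_le (k : 'I_n) w : sig (psi (Z k w)) * weight k w ^+ 2 <= C.
Proof.
apply: (@le_trans _ _ (C * weight k w ^+ 2)); last first.
  by rewrite ler_piMr// expr_le1// ?weight_ge0// weight_le1.
have iS0 : 0 <= (total_weight w)^-1 by rewrite invr_ge0 total_weight_ge0.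
rewrite /weight expr2 !mulrA; do 3 (apply: ler_wpM2r => //).
Qed.

Lemma integrable_sig_weight (k : 'I_n) :
  P.-integrable setT (EFin \o (fun w => sig (psi (Z k w)) * weight k w ^+ 2)).
Proof.
apply: (@integrable_bounded _ _ _ P _ C).
  apply: measurable_funM; last exact/measurable_funX/measurable_weight.
  by apply: (measurableT_comp msig); exact: measurableT_comp.
by move=> w; rewrite ger0_norm ?sig_weight_le// mulr_ge0// sqr_ge0.
Qed.

(** Stated in the extended reals because the left side is not yet known to be finite: its finiteness
    follows from this very identity, the right integrand being bounded. *)
Lemma integral_sqr_noise (k : 'I_n) :
  (\int[P]_w ((e (Z k w) * weight k w) ^+ 2)%:E =
   \int[P]_w (sig (psi (Z k w)) * weight k w ^+ 2)%:E)%E.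
Proof.
have := @ge0_integral_others_weighted _ _ _ T _ P Z n k mZ indZ _ U psi mpsi
  (fun z => e z ^+ 2) (fun z => sig (psi z)) (fun x => @share k x ^+ 2).
move=> /(_ (measurable_funX 2 me) (fun z => sqr_ge0 _) (measurableT_comp msig mpsi)
   (fun z => sig0 _) (e2 k) (measurable_funX 2 (@mshare k)) (fun x => sqr_ge0 _)).
have shE (c : T -> R) :
    (fun w => (c (Z k w) * share (psi (Z k w), w : others_type k) ^+ 2)%:E) =
    (fun w => (c (Z k w) * weight k w ^+ 2)%:E).
  by apply/funext => w; rewrite shareE.
rewrite (shE (fun z => e z ^+ 2)) (shE (fun z => sig (psi z))) => <-.
by apply: eq_integral => w _; rewrite exprMn.
Qed.

Lemma integrable_sqr_noise (k : 'I_n) :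
  P.-integrable setT (EFin \o (fun w => (e (Z k w) * weight k w) ^+ 2)).
Proof.
apply/integrableP; split.
  by apply/measurable_EFinP; apply: measurable_funX; exact: mnoise.
under eq_integral do rewrite /= ger0_norm ?sqr_ge0//.
rewrite integral_sqr_noise.
exact: (integrable_lty measurableT (integrable_sig_weight k)).
Qed.

(** Given [psi (Z k)] and all other observations, the noise of [Z l] included, only [e (Z k)]
    remains random, with mean 0: both weights depend on [Z k] through [psi] alone. *)
Lemma noise_orthogonal (k l : 'I_n) : k != l ->
  \int[P]_w ((e (Z k w) * weight k w) * (e (Z l w) * weight l w)) = 0.
Proof.
move=> kl.
(* Both weights have the same denominator, hence the square; it is written with [rest k] so that the
   k-th observation enters only through the first argument. *)
pose hl (x : U * others_type k) := kap x.1 / (kap x.1 + rest k x.2) ^+ 2 *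
  (e (Z l x.2) * kap (psi (Z l x.2))).
have hlE w : e (Z k w) * hl (psi (Z k w), w : others_type k) =
    (e (Z k w) * weight k w) * (e (Z l w) * weight l w).
  by rewrite /hl/= -(totalE k) /weight expr2 invfM; ring.
have mhl : measurable_fun setT hl.
  have lk : l != k by rewrite eq_sym.
  have mZl : measurable_fun setT (Z l : others_type k -> T) by exact: measurable_others.
  apply: measurable_funM.
    apply: measurable_funM; first exact: (measurableT_comp mkap measurable_fst).
    apply: (measurableT_comp (@measurable_invr R)); apply: measurable_funX.
    apply: measurable_funD; first exact: (measurableT_comp mkap measurable_fst).
    exact: (measurableT_comp (@mrest k) measurable_snd).
  have mZl' := measurableT_comp mZl (@measurable_snd _ _ U (others_type k)).
  apply: measurable_funM; first exact: (measurableT_comp me mZl').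
  exact: (measurableT_comp mkap (measurableT_comp mpsi mZl')).
have := @integral_others_centered _ _ _ T _ P Z n k mZ indZ _ U psi mpsi e
  hl me (ie k) (e0 k) mhl.
have -> : (fun w => (e (Z k w) * hl (psi (Z k w), w : others_type k))%:E) =
    EFin \o (fun w => (e (Z k w) * weight k w) * (e (Z l w) * weight l w)).
  by apply/funext => w; rewrite hlE.
rewrite /Rintegral => ->//.
apply: (integrable_mul_sqr (@mnoise k) (@mnoise l)); exact: integrable_sqr_noise.
Qed.

Lemma Rintegral_sum_noise :
  P.-integrable setT (EFin \o (fun w => \sum_(k < n) e (Z k w) * weight k w)) /\
  \int[P]_w (\sum_(k < n) e (Z k w) * weight k w) = 0.
Proof.
split; first by apply: integrable_sumr => k; exact: integrable_noise.
rewrite Rintegral_sum; last by move=> k; exact: integrable_noise.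
by rewrite big1// => k _; exact: Rintegral_noise.
Qed.

Lemma Rintegral_sqr_sum_noise :
  P.-integrable setT (EFin \o (fun w => (\sum_(k < n) e (Z k w) * weight k w) ^+ 2)) /\
  \int[P]_w ((\sum_(k < n) e (Z k w) * weight k w) ^+ 2) =
  \int[P]_w (\sum_(k < n) sig (psi (Z k w)) * weight k w ^+ 2).
Proof.
have [i ->] := sqr_sum_orthogonal (@mnoise) integrable_sqr_noise noise_orthogonal.
split => //; rewrite Rintegral_sum; last exact: integrable_sig_weight.
by apply: eq_bigr => k _; rewrite /Rintegral integral_sqr_noise.
Qed.

End weights.

(** * Elementary inequalities *)

Lemma normr_le_sqr_amgm (R : realFieldType) (L x : R) : 0 < L ->
  `|x| <= (L * x ^+ 2 + L^-1) / 2.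
Proof.
move=> L0; rewrite -(real_normK (num_real x)); move: `|x| => a.
have : 0 <= (L * a - 1) ^+ 2 / L by rewrite divr_ge0 ?sqr_ge0 ?ltW.
have -> : (L * a - 1) ^+ 2 / L = L * a ^+ 2 - 2 * a + L^-1.
  by field; rewrite ?gt_eqF//.
lra.
Qed.

(** Here [s] and [q] will be sums divided by [N], and [mu] and [mu2] their means. Since only squared
    deviations have small expectations, first-order deviations are converted by AM-GM with parameter
    [L]. The lower bound on [s] gives [1 / s^2 <= 16 / k1^2], the source of the numerical
    factors. *)
Lemma ratio_sqr_perturbation (R : realFieldType) (k0 k1 s mu q mu2 L : R) :
  0 < k1 -> 0 < L -> k1 / 4 <= s -> k1 <= mu <= k0 -> 0 <= mu2 <= k0 ^+ 2 ->
  `|q / s ^+ 2 - mu2 / mu ^+ 2| <=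
  8 / k1 ^+ 2 * (L * (q - mu2) ^+ 2 + L^-1) +
  16 * k0 ^+ 2 / k1 ^+ 4 * (s - mu) ^+ 2 +
  16 * k0 ^+ 3 / k1 ^+ 4 * (L * (s - mu) ^+ 2 + L^-1).
Proof.
move=> k1_gt0 L0 ks /andP[k1mu muk0] /andP[mu20 mu2k].
have s0 : 0 < s by rewrite (lt_le_trans _ ks)// divr_gt0.
have mu0 : 0 < mu by exact: lt_le_trans k1mu.
have k00 : 0 < k0 by exact: lt_le_trans muk0.
have is2 : s ^- 2 <= 16 / k1 ^+ 2.
  have -> : 16 / k1 ^+ 2 = (k1 / 4) ^- 2 by rewrite expr_div_n invf_div -natrX.
  rewrite lef_pV2 ?posrE ?exprn_gt0 ?divr_gt0//.
  by rewrite lerXn2r// nnegrE ltW// divr_gt0.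
have mu2mu : mu2 / mu ^+ 2 <= k0 ^+ 2 / k1 ^+ 2.
  apply: ler_pM => //; first by rewrite invr_ge0 sqr_ge0.
  rewrite lef_pV2 ?posrE ?exprn_gt0//.
  by rewrite lerXn2r// nnegrE ltW.
have mu2mu0 : 0 <= mu2 / mu ^+ 2 by rewrite divr_ge0 ?sqr_ge0.
have -> : q / s ^+ 2 - mu2 / mu ^+ 2 =
    (q - mu2) * s ^- 2 + (mu2 / mu ^+ 2) * s ^- 2 * ((mu - s) * (mu + s)).
  by field; rewrite ?gt_eqF//.
have is20 : 0 <= s ^- 2 by rewrite invr_ge0 sqr_ge0.
apply: (le_trans (ler_normD _ _)); rewrite -addrA; apply: lerD.
  rewrite normrM (ger0_norm is20).
  have -> : 8 / k1 ^+ 2 * (L * (q - mu2) ^+ 2 + L^-1) =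
      (L * (q - mu2) ^+ 2 + L^-1) / 2 * (16 / k1 ^+ 2).
    by field; rewrite ?gt_eqF//.
  by apply: ler_pM => //; exact: normr_le_sqr_amgm.
rewrite normrM (ger0_norm (mulr_ge0 mu2mu0 is20)).
have -> : 16 * k0 ^+ 2 / k1 ^+ 4 * (s - mu) ^+ 2 +
    16 * k0 ^+ 3 / k1 ^+ 4 * (L * (s - mu) ^+ 2 + L^-1) =
    (k0 ^+ 2 / k1 ^+ 2) * (16 / k1 ^+ 2) *
    ((s - mu) ^+ 2 + 2 * k0 * ((L * (s - mu) ^+ 2 + L^-1) / 2)).
  by field; rewrite ?gt_eqF//.
apply: ler_pM; [exact: mulr_ge0|exact: normr_ge0|exact: ler_pM|].
have am := normr_le_sqr_amgm (s - mu) L0.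
rewrite -(real_normK (num_real (s - mu))) in am *.
rewrite normrM distrC.
(* No upper bound on [s] is at hand; expressing [mu + s] through the deviation leaves a quadratic
   term and a first-order one with factor [2 * k0]. *)
have : `|mu + s| <= `|s - mu| + 2 * k0.
  have -> : mu + s = (s - mu) + 2 * mu by ring.
  rewrite (le_trans (ler_normD _ _))// lerD2l ger0_norm ?ler_wpM2l//.
  by rewrite mulr_ge0// ltW.
have := normr_ge0 (s - mu); move: am; move: `|s - mu| `|mu + s| => a b am a0 ba.
have : a * b <= a * (a + 2 * k0) by rewrite ler_wpM2l.
have : k0 * a <= k0 * ((L * a ^+ 2 + L^-1) / 2) by rewrite ler_wpM2l// ltW.
by rewrite expr2; lra.
Qed.

(** * Bounds for a fixed sample size *)

(* In the application [psi] is the projection on the covariate, [kap] is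
   [K (|x - chi| / h)] and [A] is the closed ball of radius [h], so that [F] is
   [F(h)] and [N] is [n F(h)]; the values [rho] and [sig] stand for [r - r chi]
   and the conditional variance of the noise [e]. *)
Section bounds.
Context (d d' d'' : measure_display) (Omega : measurableType d)
  (T : measurableType d') (U : measurableType d'') (R : realType)
  (P : probability Omega R).
Variables (Z : nat -> Omega -> T) (Z0 : Omega -> T).
Hypothesis hiid : iid_copies P Z Z0.

Let mZ0 : measurable_fun setT Z0. Proof. by have [] := hiid. Qed.
Let mZ i : measurable_fun setT (Z i). Proof. by have [] := hiid. Qed.
Let indZ : mutually_independent P Z. Proof. by have [] := hiid. Qed.

Variables (psi : T -> U) (kap : U -> R) (A : set U) (k0 k1 : R).
Hypotheses (mpsi : measurable_fun setT psi) (mkap : measurable_fun setT kap).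
Hypotheses (mA : measurable A) (k1_gt0 : 0 < k1).
Hypothesis kapA : forall u, A u -> k1 <= kap u <= k0.
Hypothesis kapNA : forall u, ~ A u -> kap u = 0.
Let F := fine (P [set w | A (psi (Z0 w))]).
Variable n : nat.
Hypothesis N_gt0 : 0 < n%:R * F.
Local Notation N := (n%:R * F).
Local Notation S := (total_weight Z psi kap n).
Let m := \int[P]_w kap (psi (Z0 w)).
Let m2 := \int[P]_w (kap (psi (Z0 w)) ^+ 2).

Lemma kap_ge0 u : 0 <= kap u.
Proof.
have [/kapA/andP[ku _]|/kapNA ->//] := pselect (A u).
exact: le_trans (ltW k1_gt0) ku.
Qed.

Lemma k0_gt0 : 0 < k0.
Proof.
have : A !=set0.
  apply/set0P/eqP => A0; move: N_gt0; rewrite /F A0.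
  have -> : [set w | set0 (psi (Z0 w))] = set0 by apply/seteqP; split.
  by rewrite measure0 mulr0 ltxx.
by move=> [u /kapA/andP[k1u uk0]]; rewrite (lt_le_trans k1_gt0)// (le_trans k1u).
Qed.

Lemma kap_lb u : k1 * \1_A u <= kap u.
Proof.
rewrite indicE; have [Au|Au] := pselect (A u).
  by rewrite mem_set// mulr1; case/andP : (kapA Au).
by rewrite memNset// mulr0 kap_ge0.
Qed.

Lemma kap_ub u : kap u <= k0 * \1_A u.
Proof.
rewrite indicE; have [Au|Au] := pselect (A u).
  by rewrite mem_set// mulr1; case/andP : (kapA Au).
by rewrite memNset// mulr0 kapNA.
Qed.

Lemma kap_bound u : `|kap u| <= k0.
Proof.
rewrite ger0_norm ?kap_ge0// (le_trans (kap_ub u))// indicE.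
by rewrite ler_piMr ?(ltW k0_gt0)//; case: (_ \in _).
Qed.

Let mpZ0 : measurable_fun setT (fun w => psi (Z0 w)).
Proof. exact: measurableT_comp. Qed.

Let mkapZ0 : measurable_fun setT (fun w => kap (psi (Z0 w))).
Proof. exact: (measurableT_comp mkap mpZ0). Qed.

Let ikap : P.-integrable setT (EFin \o (fun w => kap (psi (Z0 w)))).
Proof. by apply: (@integrable_bounded _ _ _ P _ k0) => // w; exact: kap_bound. Qed.

Let mAZ : measurable [set w | A (psi (Z0 w))].
Proof. by have := mpZ0 measurableT mA; rewrite setTI. Qed.

Let iA : P.-integrable setT (EFin \o (fun w => \1_A (psi (Z0 w)))).
Proof. exact: (integrable_indicator P mAZ). Qed.

Let EA : \int[P]_w \1_A (psi (Z0 w)) = F.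
Proof. exact: (Rintegral_indic P mAZ). Qed.

Lemma mean_kap_lb : k1 * F <= m.
Proof.
rewrite -EA -RintegralZl//; apply: le_Rintegral => //.
  exact: integrable_scale.
by move=> w _; exact: kap_lb.
Qed.

Lemma mean_kap_ub : m <= k0 * F.
Proof.
rewrite -EA -RintegralZl//; apply: le_Rintegral => //.
  exact: integrable_scale.
by move=> w _; exact: kap_ub.
Qed.

Let n_gt0 : 0 < n%:R :> R.
Proof.
have := N_gt0; rewrite pmulr_lgt0// lt_neqAle fine_ge0// andbT.
by apply/eqP => F0; move: N_gt0; rewrite -[F]F0 mulr0 ltxx.
Qed.

Let F_gt0 : 0 < F. Proof. by have := N_gt0; rewrite pmulr_rgt0. Qed.

Lemma mean_kap_gt0 : 0 < m.
Proof. by rewrite (lt_le_trans _ mean_kap_lb)// mulr_gt0. Qed.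

Lemma mean_sqr_le (f : T -> R) b : measurable_fun setT f -> 0 <= b ->
  (forall z, `|f z| <= b * \1_A (psi z)) ->
  \int[P]_w (f (Z0 w) ^+ 2) <= b ^+ 2 * F.
Proof.
move=> mf b0 fb; rewrite -EA -RintegralZl//; apply: le_Rintegral => //.
- apply: (@integrable_bounded _ _ _ P _ (b ^+ 2)).
    by apply: measurable_funX; exact: measurableT_comp.
  move=> w; rewrite normrX lerXn2r ?nnegrE// (le_trans (fb _))//.
  by rewrite ler_piMr// indicE; case: (_ \in _).
- exact: integrable_scale.
move=> w _; have := fb (Z0 w); rewrite indicE; case: (_ \in _) => /=.
  by rewrite !mulr1 -(real_normK (num_real _)) => fw; rewrite lerXn2r ?nnegrE.
by rewrite !mulr0 normr_le0 => /eqP ->; rewrite expr0n.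
Qed.

(** The variance of a summand is at most its second moment, which is of order [F] because [f]
    vanishes off [A]. The sum therefore has a variance of order [N] rather than [n]. *)
Lemma sqr_sum_le (f : T -> R) b : measurable_fun setT f -> 0 <= b ->
  (forall z, `|f z| <= b * \1_A (psi z)) ->
  P.-integrable setT (EFin \o
    (fun w => (\sum_(k < n) f (Z k w) - n%:R * \int[P]_w f (Z0 w)) ^+ 2)) /\
  \int[P]_w ((\sum_(k < n) f (Z k w) - n%:R * \int[P]_w f (Z0 w)) ^+ 2) <=
    b ^+ 2 * N.
Proof.
move=> mf b0 fb; set a := \int[P]_w f (Z0 w).
have fb' z : `|f z| <= b.
  by rewrite (le_trans (fb z))// ler_piMr// indicE; case: (_ \in _).
have mfZ : measurable_fun setT (fun w => f (Z0 w)) by exact: measurableT_comp.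
have ifZ : P.-integrable setT (EFin \o (fun w => f (Z0 w))).
  exact: (@integrable_bounded _ _ _ P _ b).
have ica : P.-integrable setT (EFin \o (fun _ : Omega => a)).
  exact: (@finite_measure_integrable_cst _ _ _ P).
pose g z := f z - a.
have mg : measurable_fun setT g by exact: measurable_funB.
have gb z : `|g z| <= b + `|a| by rewrite (le_trans (ler_normB _ _))// lerD2r.
have g0 : \int[P]_w g (Z0 w) = 0.
  by rewrite RintegralB// Rintegral_prob_cst subrr.
have [ig Eg] := sqr_sum_iid_centered hiid n mg gb g0.
have gE w : \sum_(k < n) g (Z k w) = \sum_(k < n) f (Z k w) - n%:R * a.
  by rewrite sumrB sumr_const card_ord mulr_natl.
have {}gE : (fun w => (\sum_(k < n) g (Z k w)) ^+ 2) =
    (fun w => (\sum_(k < n) f (Z k w) - n%:R * a) ^+ 2).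
  by apply/funext => w; rewrite gE.
rewrite -gE; split => //; rewrite Eg mulrCA ler_wpM2l//.
apply: le_trans (mean_sqr_le mf b0 fb).
have if2 : P.-integrable setT (EFin \o (fun w => f (Z0 w) ^+ 2)).
  apply: (@integrable_bounded _ _ _ P _ (b ^+ 2)); first exact: measurable_funX.
  by move=> w; rewrite normrX lerXn2r ?nnegrE.
have -> : \int[P]_w (g (Z0 w) ^+ 2) = \int[P]_w (f (Z0 w) ^+ 2) - a ^+ 2.
  transitivity (\int[P]_w (f (Z0 w) ^+ 2 - ((2 * a) * f (Z0 w) - a ^+ 2))).
    by apply: eq_Rintegral => w _; rewrite /g; ring.
  have ica2 : P.-integrable setT (EFin \o (fun _ : Omega => a ^+ 2)).
    exact: (@finite_measure_integrable_cst _ _ _ P).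
  have i2 := integrable_scale (2 * a) ifZ.
  rewrite RintegralB//; last exact: integrable_sub.
  by rewrite RintegralB// RintegralZl// Rintegral_prob_cst -/a; ring.
by rewrite gerBl sqr_ge0.
Qed.


Let mS : measurable_fun setT S.
Proof. exact: (measurable_total_weight hiid). Qed.

Let S_ge0 w : 0 <= S w. Proof. exact: total_weight_ge0 kap_ge0 _ _. Qed.

(* A majorant of the indicator of [S <= k1 N / 4] with an exponentially small
   mean: off this event [1 / S] is of order [1 / N]. *)
Definition lower_tail w := expR (N / 4 - S w / k1).

Lemma lower_tail_ge0 w : 0 <= lower_tail w.
Proof. exact: expR_ge0. Qed.

Lemma lower_tail_ge1 w : S w <= k1 / 4 * N -> 1 <= lower_tail w.
Proof.
move=> Sw; rewrite -expR0 ler_expR subr_ge0 ler_pdivrMr//.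
by rewrite mulrAC [N * k1]mulrC mulrAC.
Qed.

Lemma lower_tail_le w : lower_tail w <= expR (N / 4).
Proof. by rewrite ler_expR gerBl divr_ge0// ltW. Qed.

Lemma measurable_lower_tail : measurable_fun setT lower_tail.
Proof.
apply: (measurableT_comp (@measurable_expR R)); apply: measurable_funB => //.
exact: measurable_funM.
Qed.

Lemma integrable_lower_tail : P.-integrable setT (EFin \o lower_tail).
Proof.
apply: (@integrable_bounded _ _ _ P _ (expR (N / 4))).
  exact: measurable_lower_tail.
by move=> w; rewrite ger0_norm ?lower_tail_ge0// lower_tail_le.
Qed.

(** Chernoff's method with parameter [1 / k1]: on [A] the exponent [kap / k1] is at least 1 and
    [exp 1 >= 2], so one factor has mean at most [1 - F / 2 <= exp (- F / 2)]. The product over the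
    sample leaves [exp (N / 4 - N / 2) = exp (N / 8) ^ (-2)], and [exp x >= x] gives the square of
    [8 / N]. *)
Lemma mean_lower_tail : \int[P]_w lower_tail w <= 64 / N ^+ 2.
Proof.
pose g z := expR (- (kap (psi z) / k1)).
have mg : measurable_fun setT g.
  apply: (measurableT_comp (@measurable_expR R)); apply: measurableT_comp => //.
  by apply: measurable_funM => //; exact: measurableT_comp.
have gA z : g z <= 1 - 2^-1 * \1_A (psi z).
  rewrite /g indicE; have [Az|Az] := pselect (A (psi z)).
    rewrite mem_set// mulr1 expRN.
    have /andP[k1z _] := kapA Az.
    have e2 : 2 <= expR (kap (psi z) / k1).
      apply: (le_trans _ (expR_ge1Dx _)); rewrite -[leLHS]/(1 + 1) lerD2l.
      by rewrite ler_pdivlMr// mul1r.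
    have : (expR (kap (psi z) / k1))^-1 <= 2^-1.
      by rewrite lef_pV2 ?posrE// expR_gt0.
    lra.
  by rewrite memNset// mulr0 subr0 kapNA// mul0r oppr0 expR0.
have mgZ : measurable_fun setT (fun w => g (Z0 w)) by exact: measurableT_comp.
have igZ : P.-integrable setT (EFin \o (fun w => g (Z0 w))).
  apply: (@integrable_bounded _ _ _ P _ 1) => // w.
  by rewrite ger0_norm ?expR_ge0// (le_trans (gA _))// gerBl mulr_ge0.
have Eg : \int[P]_w g (Z0 w) <= expR (- (F / 2)).
  apply: (@le_trans _ _ (1 - 2^-1 * F)); last first.
    by apply: (le_trans _ (expR_ge1Dx _)); rewrite mulrC.
  have ic1 : P.-integrable setT (EFin \o (fun _ : Omega => 1)).
    exact: (@finite_measure_integrable_cst _ _ _ P).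
  have i2A := integrable_scale 2^-1 iA.
  have -> : 1 - 2^-1 * F = \int[P]_w (1 - 2^-1 * \1_A (psi (Z0 w))).
    by rewrite RintegralB// RintegralZl// Rintegral_prob_cst EA.
  by apply: le_Rintegral => //; exact: integrable_sub.
have g0 z : 0 <= g z by exact: expR_ge0.
have -> : \int[P]_w lower_tail w = expR (N / 4) * (\int[P]_w g (Z0 w)) ^+ n.
  have lE w : lower_tail w = expR (N / 4) * \prod_(k < n) g (Z k w).
    rewrite /lower_tail expRD; congr (_ * _).
    by rewrite -expR_sum /total_weight mulr_suml sumrN.
  transitivity (\int[P]_w (expR (N / 4) * \prod_(k < n) g (Z k w))).
    by apply: eq_Rintegral => w _; exact: lE.
  rewrite RintegralZl//; first by rewrite {1}/Rintegral (integral_prod_iid hiid).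
  apply: (@integrable_bounded _ _ _ P _ 1).
    apply: (measurable_prod (s := index_enum _)) => k _.
    exact: measurableT_comp.
  move=> w; rewrite ger0_norm ?prodr_ge0//; apply: prodr_ile1 => k _.
  by rewrite g0/= (le_trans (gA _))// gerBl mulr_ge0.
apply: (@le_trans _ _ (expR (N / 4) * expR (- (F / 2)) ^+ n)).
  rewrite ler_wpM2l ?expR_ge0// lerXn2r// nnegrE ?expR_ge0//.
  by apply: Rintegral_ge0 => w _; exact: g0.
rewrite -expRM_natl -expRD.
have -> : N / 4 + n%:R * - (F / 2) = - (N / 8 + N / 8) by field.
rewrite expRN expRD -expr2.
have e8 : N / 8 <= expR (N / 8) by rewrite (le_trans _ (expR_ge1Dx _))// lerDr.
have N8 : 0 < N / 8 by rewrite divr_gt0.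
have -> : 64 / N ^+ 2 = ((N / 8) ^+ 2)^-1.
  by rewrite expr_div_n invf_div -natrX.
rewrite lef_pV2 ?posrE; [|by rewrite exprn_gt0// expR_gt0|by rewrite exprn_gt0].
by rewrite lerXn2r// nnegrE ?expR_ge0// ltW.
Qed.


(** * The weighted mean of the regression increments *)

Local Notation W k w := (weight Z psi kap n k w).

Variables (rho : U -> R) (delta : R).
Hypotheses (mrho : measurable_fun setT rho) (delta_ge0 : 0 <= delta).
Hypothesis rhoA : forall u, A u -> `|rho u| <= delta.

Definition local_mean := \int[P]_w (rho (psi (Z0 w)) * kap (psi (Z0 w))) / m.

Local Notation c := local_mean.

Lemma rho_kap_le u : `|rho u * kap u| <= delta * kap u.
Proof.
have [Au|/kapNA->] := pselect (A u); last by rewrite !mulr0 normr0.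
by rewrite normrM (ger0_norm (kap_ge0 u)) ler_wpM2r ?kap_ge0// rhoA.
Qed.

Let mrk : measurable_fun setT (fun w => rho (psi (Z0 w)) * kap (psi (Z0 w))).
Proof. by apply: measurable_funM => //; exact: (measurableT_comp mrho mpZ0). Qed.

Let irk : P.-integrable setT (EFin \o (fun w => rho (psi (Z0 w)) * kap (psi (Z0 w)))).
Proof.
apply: (integrable_dominated mrk (g := fun w => delta * kap (psi (Z0 w)))).
  by move=> w; exact: rho_kap_le.
exact: integrable_scale.
Qed.

Lemma local_mean_le : `|c| <= delta.
Proof.
rewrite normrM normfV (gtr0_norm mean_kap_gt0) ler_pdivrMr ?mean_kap_gt0//.
apply: (le_trans (le_normr_Rintegral _ irk)) => //.
rewrite -RintegralZl//; apply: le_Rintegral => //.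
- exact: integrable_norm irk.
- exact: integrable_scale.
- by move=> w _; exact: rho_kap_le.
Qed.

(** A summand of the numerator; taking for [c] the kernel-weighted mean of [rho] is what centers
    it. *)
Let xi z := kap (psi z) * (rho (psi z) - c).

Let mxi : measurable_fun setT xi.
Proof.
apply: measurable_funM; first exact: measurableT_comp.
by apply: measurable_funB => //; exact: measurableT_comp.
Qed.

Let xi_le z : `|xi z| <= 2 * delta * kap (psi z).
Proof.
rewrite /xi; have [Az|/kapNA->] := pselect (A (psi z)); last first.
  by rewrite mul0r normr0 mulr0.
rewrite normrM (ger0_norm (kap_ge0 _)) mulrC ler_wpM2r ?kap_ge0//.
rewrite (le_trans (ler_normB _ _))// mulr_natl mulr2n lerD ?rhoA//.
exact: local_mean_le.
Qed.

Let xi_bound z : `|xi z| <= 2 * delta * k0 * \1_A (psi z).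
Proof.
by rewrite (le_trans (xi_le z))// -[leRHS]mulrA ler_wpM2l ?mulr_ge0// kap_ub.
Qed.

Let mean_xi : \int[P]_w xi (Z0 w) = 0.
Proof.
transitivity (\int[P]_w (rho (psi (Z0 w)) * kap (psi (Z0 w)) - c * kap (psi (Z0 w)))).
  by apply: eq_Rintegral => w _; rewrite /xi mulrBr mulrC (mulrC c).
rewrite RintegralB//; last exact: integrable_scale.
by rewrite RintegralZl// /local_mean divfK ?subrr// gt_eqF// mean_kap_gt0.
Qed.

Let Xi w := \sum_(k < n) xi (Z k w).

Let Xi_sqr : P.-integrable setT (EFin \o (fun w => Xi w ^+ 2)) /\
  \int[P]_w (Xi w ^+ 2) <= (2 * delta * k0) ^+ 2 * N.
Proof.
have b0 : 0 <= 2 * delta * k0 by rewrite !mulr_ge0// ltW// k0_gt0.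
have := sqr_sum_le mxi b0 xi_bound; rewrite mean_xi mulr0.
have -> : (fun w => (\sum_(k < n) xi (Z k w) - 0) ^+ 2) = (fun w => Xi w ^+ 2).
  by apply/funext => w; rewrite subr0.
by [].
Qed.

Let Xi_le w : `|Xi w| <= 2 * delta * S w.
Proof.
rewrite /total_weight mulr_sumr; apply: (le_trans (ler_norm_sum _ _ _)).
by apply: ler_sum => k _; exact: xi_le.
Qed.

(* Equal to [0] when [S = 0], all weights being then [0 / 0 = 0]. *)
Definition fluctuation w := \sum_(k < n) (rho (psi (Z k w)) - c) * W k w.

Local Notation D := fluctuation.

Let DE w : D w = Xi w / S w.
Proof.
by rewrite /fluctuation /Xi mulr_suml; apply: eq_bigr => k _; rewrite /weight /xi; ring.
Qed.

Let D_le w : `|D w| <= 2 * delta.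
Proof.
rewrite DE normrM normfV (ger0_norm (S_ge0 w)).
have := S_ge0 w; rewrite le_eqVlt => /predU1P[<-|Sw].
  by rewrite invr0 mulr0 mulr_ge0.
by rewrite ler_pdivrMr.
Qed.

Lemma measurable_fluctuation : measurable_fun setT D.
Proof.
rewrite /fluctuation; apply: measurable_sum => k; apply: measurable_funM.
  apply: measurable_funB => //; apply: (measurableT_comp mrho).
  exact: (measurableT_comp mpsi (mZ k)).
exact: (measurable_weight hiid).
Qed.

Lemma integrable_fluctuation : P.-integrable setT (EFin \o D).
Proof. exact: integrable_bounded measurable_fluctuation D_le. Qed.

Let kapp_gt0 : 0 < k1 / 4 * N. Proof. by rewrite mulr_gt0// divr_gt0. Qed.

Lemma integrable_fluctuation_sqr : P.-integrable setT (EFin \o (fun w => D w ^+ 2)).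
Proof.
apply: (@integrable_bounded _ _ _ P _ ((2 * delta) ^+ 2)).
  by apply: measurable_funX; exact: measurable_fluctuation.
by move=> w; rewrite normrX lerXn2r ?nnegrE// mulr_ge0.
Qed.

(** On the event that [S] is small, the deterministic bound [|D| <= 2 delta] is paid for by
    [lower_tail]; off it, [D^2] is at most [Xi^2] over the square of the threshold. Both
    contributions carry [delta^2], which later makes them [o(1 / N)]. *)
Lemma fluctuation_sqr : \int[P]_w (D w ^+ 2) <=
  (2 * delta) ^+ 2 * ((4 * k0 / k1) ^+ 2 / N + 64 / N ^+ 2).
Proof.
have [iX EX] := Xi_sqr; have ib := integrable_lower_tail; have Eb := mean_lower_tail.
have iX' := integrable_scale ((k1 / 4 * N) ^- 2) iX.
have ib' := integrable_scale ((2 * delta) ^+ 2) ib.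
apply: (@le_trans _ _ (\int[P]_w ((k1 / 4 * N) ^- 2 * Xi w ^+ 2 +
    (2 * delta) ^+ 2 * lower_tail w))).
  apply: le_Rintegral => //.
  - exact: integrable_fluctuation_sqr.
  - exact: integrable_add.
  move=> w _; have [Sw|Sw] := leP (S w) (k1 / 4 * N).
    rewrite -[leLHS]add0r lerD//.
      by rewrite mulr_ge0 ?invr_ge0 ?sqr_ge0.
    rewrite -(real_normK (num_real (D w))) -[leLHS]mulr1 ler_pM ?sqr_ge0//.
      by rewrite lerXn2r ?nnegrE// mulr_ge0.
    exact: lower_tail_ge1.
  rewrite -[leLHS]addr0 lerD ?mulr_ge0 ?sqr_ge0 ?lower_tail_ge0//.
  have S0 : 0 < S w by exact: lt_trans Sw.
  rewrite DE expr_div_n mulrC ler_wpM2r ?sqr_ge0//.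
  rewrite lef_pV2 ?posrE ?exprn_gt0//.
  by rewrite lerXn2r ?nnegrE ?ltW.
rewrite RintegralD// RintegralZl// RintegralZl// [leRHS]mulrDr lerD//; last first.
  by rewrite ler_wpM2l ?sqr_ge0.
apply: (@le_trans _ _ ((k1 / 4 * N) ^- 2 * ((2 * delta * k0) ^+ 2 * N))).
  by rewrite ler_wpM2l// invr_ge0 sqr_ge0.
rewrite le_eqVlt; apply/orP; left; apply/eqP.
have k1n := gt_eqF k1_gt0; have nn := gt_eqF n_gt0; have Fn := gt_eqF F_gt0.
by field; rewrite ?k1n ?nn ?Fn.
Qed.

Let S_sqr : P.-integrable setT (EFin \o (fun w => (S w - n%:R * m) ^+ 2)) /\
  \int[P]_w ((S w - n%:R * m) ^+ 2) <= k0 ^+ 2 * N.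
Proof.
have := @sqr_sum_le (fun z => kap (psi z)) k0 (measurableT_comp mkap mpsi) (ltW k0_gt0).
apply => z; rewrite ger0_norm ?kap_ge0//; exact: kap_ub.
Qed.

(** This survives [S w = 0], since [|Xi| <= 2 delta S]. *)
Let DS w : D w * S w = Xi w.
Proof.
rewrite DE; have := S_ge0 w; rewrite le_eqVlt => /predU1P[S0|Sw]; last first.
  by rewrite divfK// gt_eqF.
rewrite -S0 mulr0; have := Xi_le w; rewrite -S0 mulr0 normr_le0.
by move=> /eqP ->.
Qed.

Let iXi : P.-integrable setT (EFin \o Xi).
Proof.
apply: integrable_sumr => k.
apply: (@integrable_bounded _ _ _ P _ (2 * delta * k0)).
  exact: (measurableT_comp mxi (mZ k)).
move=> w; rewrite (le_trans (xi_bound _))// ler_piMr//.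
by rewrite !mulr_ge0// ltW// k0_gt0.
Qed.

Let mean_Xi : \int[P]_w Xi w = 0.
Proof.
rewrite Rintegral_sum; last first.
  move=> k; apply: (@integrable_bounded _ _ _ P _ (2 * delta * k0)).
    exact: (measurableT_comp mxi (mZ k)).
  move=> w; rewrite (le_trans (xi_bound _))// ler_piMr//.
  by rewrite !mulr_ge0// ltW// k0_gt0.
by rewrite big1// => k _; rewrite (Rintegral_iid hiid k mxi).
Qed.

Let nm_ge : k1 * N <= n%:R * m.
Proof. by rewrite mulrCA; apply: ler_wpM2l; [exact: ltW|exact: mean_kap_lb]. Qed.

(* [Xi / (n m)] is centered and replaces [D = Xi / S] up to second order. *)
Lemma mean_fluctuation : `|\int[P]_w D w| <=
  2 * (4 * delta ^+ 2 + 1) * (k0 / k1) ^+ 2 / N + 128 * delta / N ^+ 2.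
Proof.
have [iX EX] := Xi_sqr; have [iS ES] := S_sqr.
have ib := integrable_lower_tail; have Eb := mean_lower_tail.
have iD := integrable_fluctuation.
have nm0 : 0 < n%:R * m by rewrite mulr_gt0// mean_kap_gt0.
have iXn := integrable_scale (n%:R * m)^-1 iXi.
have -> : \int[P]_w D w = \int[P]_w (D w - (n%:R * m)^-1 * Xi w).
  by rewrite RintegralB// RintegralZl// mean_Xi mulr0 subr0.
have iXS := integrable_scale (2 / (k1 * N) ^+ 2) (integrable_add iX iS).
have ib' := integrable_scale (2 * delta) ib.
have idif := integrable_sub iD iXn.
apply: (le_trans (le_normr_Rintegral _ idif)) => //.
apply: (@le_trans _ _ (\int[P]_w (2 / (k1 * N) ^+ 2 *
    (Xi w ^+ 2 + (S w - n%:R * m) ^+ 2) + 2 * delta * lower_tail w))).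
  apply: le_Rintegral => //.
  - exact: integrable_norm idif.
  - exact: integrable_add.
  move=> w _; have [Sw|Sw] := leP (S w) (k1 / 4 * N).
    rewrite -[leLHS]add0r lerD//.
      by rewrite mulr_ge0 ?addr_ge0 ?divr_ge0 ?sqr_ge0.
    rewrite -DS.
    (* When [S] is small the factor [1 - S / (n m)] lies in [[0, 1]], so the replacement costs at
       most [|D| <= 2 delta]. *)
    have -> : D w - (n%:R * m)^-1 * (D w * S w) = D w * (1 - S w / (n%:R * m)).
      by ring.
    rewrite normrM; apply: ler_pM => //.
    apply: le_trans (lower_tail_ge1 Sw).
    have SN : S w <= n%:R * m.
      apply: (le_trans Sw); apply: le_trans nm_ge.
      by apply: ler_wpM2r; [exact: ltW|move: k1_gt0; lra].
    rewrite ger0_norm ?gerBl ?divr_ge0 ?(ltW nm0)//.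
    by rewrite subr_ge0 ler_pdivrMr// mul1r.
  rewrite -[leLHS]addr0 lerD ?mulr_ge0 ?lower_tail_ge0//.
  have S0 : 0 < S w by exact: lt_trans Sw.
  (* The error is of second order: a product of two centered sums, each of variance [O(N)], over a
     denominator of order [N^2]. *)
  have -> : D w - (n%:R * m)^-1 * Xi w =
      Xi w * (n%:R * m - S w) * (S w * (n%:R * m))^-1.
    by rewrite DE; field; rewrite ?gt_eqF ?mean_kap_gt0//.
  have Snm0 : 0 < S w * (n%:R * m) by rewrite mulr_gt0.
  rewrite normrM normfV (gtr0_norm Snm0) ler_pdivrMr// mulrAC.
  have ab : `|Xi w * (n%:R * m - S w)| <= (Xi w ^+ 2 + (S w - n%:R * m) ^+ 2) / 2.
    rewrite normrM distrC -(real_normK (num_real (Xi w))).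
    rewrite -(real_normK (num_real (S w - _))).
    move: `|Xi w| `|S w - _| => a b.
    by have := sqr_ge0 (a - b); rewrite !expr2; lra.
  apply: (le_trans ab); rewrite mulrC ler_wpM2r ?addr_ge0 ?sqr_ge0//.
  rewrite mulrAC ler_pdivlMr ?exprn_gt0 ?mulr_gt0//.
  (* The denominator is at least [(k1 N)^2 / 4], which with the factor 1/2 of the bound on the
     product gives [2 / (k1 N)^2]. *)
  have : k1 / 4 * N * (k1 * N) <= S w * (n%:R * m).
    by apply: ler_pM nm_ge; rewrite ?ltW// mulr_gt0.
  by rewrite expr2; lra.
have iXS0 := integrable_add iX iS.
have e1 : \int[P]_w (2 / (k1 * N) ^+ 2 * (Xi w ^+ 2 + (S w - n%:R * m) ^+ 2)) =
    2 / (k1 * N) ^+ 2 *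
    (\int[P]_w (Xi w ^+ 2) + \int[P]_w ((S w - n%:R * m) ^+ 2)).
  by rewrite (RintegralZl _ measurableT iXS0) RintegralD.
rewrite RintegralD// e1 RintegralZl//; apply: lerD.
  apply: (@le_trans _ _ (2 / (k1 * N) ^+ 2 *
      ((2 * delta * k0) ^+ 2 * N + k0 ^+ 2 * N))).
    by rewrite ler_wpM2l ?lerD// divr_ge0 ?sqr_ge0.
  rewrite le_eqVlt; apply/orP; left; apply/eqP.
  have k1n := gt_eqF k1_gt0; have nn := gt_eqF n_gt0; have Fn := gt_eqF F_gt0.
  by field; rewrite ?k1n ?nn ?Fn.
apply: (@le_trans _ _ (2 * delta * (64 / N ^+ 2))).
  by rewrite ler_wpM2l// mulr_ge0.
by rewrite le_eqVlt; apply/orP; left; apply/eqP; ring.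
Qed.


(** * The sum of squared weights *)

Definition sqr_weights w := \sum_(k < n) W k w ^+ 2.

Local Notation v := (m2 * F / m ^+ 2).

(** The first three terms average [ratio_sqr_perturbation], the mean squared deviations of [q / N]
    and [S / N] being at most [k0^4 / N] and [k0^2 / N]. The last is the cost of the event that [S]
    is small. *)
Definition sqr_weights_error L :=
  8 / k1 ^+ 2 * (L * (k0 ^+ 4 / N) + L^-1) +
  16 * k0 ^+ 2 / k1 ^+ 4 * (k0 ^+ 2 / N) +
  16 * k0 ^+ 3 / k1 ^+ 4 * (L * (k0 ^+ 2 / N) + L^-1) +
  (N + (k0 / k1) ^+ 2) * (64 / N ^+ 2).

Let W_ge0 (k : nat) w : 0 <= W k w. Proof. exact: weight_ge0 kap_ge0 _ _ _. Qed.

Let W_le1 (k : 'I_n) w : W k w <= 1. Proof. exact: (weight_le1 Z psi kap_ge0). Qed.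

Lemma sqr_weights_ge0 w : 0 <= sqr_weights w.
Proof. by apply: sumr_ge0 => k _; exact: sqr_ge0. Qed.

Lemma sqr_weights_le1 w : sqr_weights w <= 1.
Proof.
apply: (@le_trans _ _ (\sum_(k < n) W k w)).
  by apply: ler_sum => k _; rewrite expr2 ler_piMr// W_le1.
rewrite /weight -mulr_suml -/(S w); have := S_ge0 w.
by rewrite le_eqVlt => /predU1P[<-|Sw]; rewrite ?mul0r// divff// gt_eqF.
Qed.

Lemma measurable_sqr_weights : measurable_fun setT sqr_weights.
Proof.
rewrite /sqr_weights; apply: measurable_sum => k; apply: measurable_funX.
exact: (measurable_weight hiid).
Qed.

Lemma integrable_sqr_weights : P.-integrable setT (EFin \o sqr_weights).
Proof.
apply: (@integrable_bounded _ _ _ P _ 1); first exact: measurable_sqr_weights.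
by move=> w; rewrite ger0_norm ?sqr_weights_ge0 ?sqr_weights_le1.
Qed.

Let q w := \sum_(k < n) kap (psi (Z k w)) ^+ 2.

Let sqr_weightsE w : sqr_weights w = q w / S w ^+ 2.
Proof.
by rewrite /sqr_weights mulr_suml; apply: eq_bigr => k _; rewrite expr_div_n.
Qed.

Let q_sqr : P.-integrable setT (EFin \o (fun w => (q w - n%:R * m2) ^+ 2)) /\
  \int[P]_w ((q w - n%:R * m2) ^+ 2) <= k0 ^+ 4 * N.
Proof.
have := @sqr_sum_le (fun z => kap (psi z) ^+ 2) (k0 ^+ 2).
rewrite -exprM; apply; rewrite ?sqr_ge0//.
  by apply: measurable_funX; exact: measurableT_comp.
move=> z; rewrite normrX; have [Az|/kapNA->] := pselect (A (psi z)); last first.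
  by rewrite normr0 expr0n mulr_ge0// sqr_ge0.
rewrite indicE mem_set// mulr1 lerXn2r ?nnegrE ?kap_bound//.
by rewrite ltW// k0_gt0.
Qed.

Lemma mean_sqr_kap : 0 <= m2 <= k0 ^+ 2 * F.
Proof.
apply/andP; split; first by apply: Rintegral_ge0 => w _; exact: sqr_ge0.
apply: (mean_sqr_le (measurableT_comp mkap mpsi)); first by rewrite ltW// k0_gt0.
by move=> z; rewrite ger0_norm ?kap_ge0// kap_ub.
Qed.

Lemma sqr_weights_limit_bounds : 0 <= v <= (k0 / k1) ^+ 2.
Proof.
have /andP[m20 m2k] := mean_sqr_kap; have m0 := mean_kap_gt0.
apply/andP; split; first by rewrite divr_ge0 ?sqr_ge0// mulr_ge0// ltW.
rewrite ler_pdivrMr ?exprn_gt0//.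
apply: (@le_trans _ _ (k0 ^+ 2 * F * F)); first by rewrite ler_wpM2r// ltW.
have -> : k0 ^+ 2 * F * F = (k0 / k1) ^+ 2 * (k1 * F) ^+ 2.
  by field; rewrite gt_eqF.
rewrite ler_wpM2l ?sqr_ge0// lerXn2r ?nnegrE ?mean_kap_lb//.
  by rewrite mulr_ge0 ?ltW.
by rewrite ltW.
Qed.

Lemma integrable_sqr_weights_dist :
  P.-integrable setT (EFin \o (fun w => `|N * sqr_weights w - v|)).
Proof.
apply: integrable_norm (integrable_sub (integrable_scale N integrable_sqr_weights) _).
exact: (@finite_measure_integrable_cst _ _ _ P).
Qed.

(* [L] is a free parameter of the AM-GM inequality [2 |x| <= L x^2 + 1 / L], which
   turns variance bounds into bounds in mean. *)
Lemma sqr_weights_cvg L : 0 < L ->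
  \int[P]_w `|N * sqr_weights w - v| <= sqr_weights_error L.
Proof.
move=> L0; have [iq Eq] := q_sqr; have [iS ES] := S_sqr.
have ib := integrable_lower_tail; have Eb := mean_lower_tail.
have ic (a : R) : P.-integrable setT (EFin \o (fun _ : Omega => a)).
  exact: (@finite_measure_integrable_cst _ _ _ P).
have /andP[v0 vk] := sqr_weights_limit_bounds.
have m0 := mean_kap_gt0; have k00 := k0_gt0.
have kk0 : 0 <= N + (k0 / k1) ^+ 2 by rewrite addr_ge0 ?sqr_ge0// ltW.
pose a1 := 8 / k1 ^+ 2; pose a2 := 16 * k0 ^+ 2 / k1 ^+ 4.
pose a3 := 16 * k0 ^+ 3 / k1 ^+ 4.
have a10 : 0 <= a1 by rewrite divr_ge0// ltW// exprn_gt0.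
have a20 : 0 <= a2 by rewrite divr_ge0 ?mulr_ge0// ltW// exprn_gt0.
have a30 : 0 <= a3 by rewrite divr_ge0 ?mulr_ge0// ltW// exprn_gt0.
pose aq := a1 * L / N ^+ 2; pose aS := (a2 + a3 * L) / N ^+ 2.
have aq0 : 0 <= aq by rewrite !mulr_ge0 ?invr_ge0 ?sqr_ge0// ltW.
have aS0 : 0 <= aS by rewrite divr_ge0 ?sqr_ge0// addr_ge0// mulr_ge0// ltW.
pose ac := (a1 + a3) / L.
have i1 := integrable_scale aq iq; have i2 := integrable_scale aS iS.
have i3 := integrable_scale (N + (k0 / k1) ^+ 2) ib.
have i12 := integrable_add i1 i2; have i123 := integrable_add i12 i3.
have i4 := integrable_add i123 (ic ac).
apply: (@le_trans _ _ (\int[P]_w (aq * (q w - n%:R * m2) ^+ 2 +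
    aS * (S w - n%:R * m) ^+ 2 + (N + (k0 / k1) ^+ 2) * lower_tail w + ac))).
  apply: le_Rintegral => //; first exact: integrable_sqr_weights_dist.
  move=> w _; have ac0 : 0 <= ac by rewrite divr_ge0 ?addr_ge0// ltW.
  have [Sw|Sw] := leP (S w) (k1 / 4 * N).
    (* When [S] is small, the crude bounds [sqr_weights <= 1] and [v <= (k0 / k1)^2] are used. *)
    apply: (@le_trans _ _ ((N + (k0 / k1) ^+ 2) * lower_tail w)); last first.
      rewrite -[leLHS]addr0 lerD// -[leLHS]add0r lerD// addr_ge0//.
        by rewrite mulr_ge0 ?sqr_ge0.
      by rewrite mulr_ge0 ?sqr_ge0.
    apply: (@le_trans _ _ (N + (k0 / k1) ^+ 2)); last first.
      by rewrite ler_peMr// lower_tail_ge1.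
    rewrite (le_trans (ler_normB _ _))// lerD//; last by rewrite ger0_norm.
    rewrite ger0_norm; last by apply: mulr_ge0; [exact: ltW|exact: sqr_weights_ge0].
    by rewrite ler_piMr ?sqr_weights_le1// ltW.
  apply: (@le_trans _ _ (aq * (q w - n%:R * m2) ^+ 2 +
    aS * (S w - n%:R * m) ^+ 2 + ac)); last first.
    by rewrite lerD2r lerDl mulr_ge0// lower_tail_ge0.
  have S0 : 0 < S w by exact: lt_trans Sw.
  have muB : k1 <= m / F <= k0.
    by rewrite ler_pdivlMr// ler_pdivrMr// mean_kap_lb mean_kap_ub.
  have mu2B : 0 <= m2 / F <= k0 ^+ 2.
    by rewrite ler_pdivlMr// ler_pdivrMr// mul0r mean_sqr_kap.
  have sB : k1 / 4 <= S w / N by rewrite ler_pdivlMr// ltW.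
  (* After normalization [N * sqr_weights] reads [(q / N) / (S / N)^2], and [v] reads
     [(m2 / F) / (m / F)^2]. *)
  have := ratio_sqr_perturbation (q w / N) k1_gt0 L0 sB muB mu2B.
  have [nn Fn] := (gt_eqF n_gt0, gt_eqF F_gt0).
  have [Sn mn] := (gt_eqF S0, gt_eqF m0).
  have -> : q w / N / (S w / N) ^+ 2 - m2 / F / (m / F) ^+ 2 =
      N * sqr_weights w - v.
    by rewrite sqr_weightsE; field; rewrite ?nn ?Fn ?Sn ?mn.
  move=> /le_trans; apply; rewrite -/a1 -/a2 -/a3 le_eqVlt.
  apply/orP; left; apply/eqP; rewrite /aq /aS /ac.
  by field; rewrite ?nn ?Fn ?(gt_eqF L0).
rewrite RintegralD// RintegralD// RintegralD// Rintegral_prob_cst.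
rewrite (RintegralZl _ measurableT iq) (RintegralZl _ measurableT iS).
rewrite (RintegralZl _ measurableT ib).
apply: (@le_trans _ _ (aq * (k0 ^+ 4 * N) + aS * (k0 ^+ 2 * N) +
    (N + (k0 / k1) ^+ 2) * (64 / N ^+ 2) + ac)).
  by apply: lerD => //; apply: lerD; [apply: lerD|]; exact: ler_wpM2l.
rewrite le_eqVlt; apply/orP; left; apply/eqP.
rewrite /sqr_weights_error -/a1 -/a2 -/a3 /aq /aS /ac.
have [nn Fn] := (gt_eqF n_gt0, gt_eqF F_gt0).
by field; rewrite ?nn ?Fn ?(gt_eqF L0) ?(gt_eqF k1_gt0).
Qed.


(** * The noise term *)

Variables (e : T -> R) (sig : U -> R) (s0 : R).
Hypotheses (me : measurable_fun setT e) (msig : measurable_fun setT sig).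
Hypotheses (sig_ge0 : forall u, 0 <= sig u) (s0_ge0 : 0 <= s0).
Hypothesis ie : forall k, P.-integrable setT (EFin \o (fun w => e (Z k w))).
Hypothesis e0 : forall k B, measurable B ->
  (\int[P]_(w in (fun w => psi (Z k w)) @^-1` B) (e (Z k w))%:E = 0)%E.
Hypothesis e2 : forall k B, measurable B ->
  (\int[P]_(w in (fun w => psi (Z k w)) @^-1` B) (e (Z k w) ^+ 2)%:E =
   \int[P]_(w in (fun w => psi (Z k w)) @^-1` B) (sig (psi (Z k w)))%:E)%E.
Hypothesis sigA : forall u, A u -> `|sig u - s0| <= delta.

Definition noise w := \sum_(k < n) e (Z k w) * W k w.

Let sig_le u : sig u * kap u <= (s0 + delta) * kap u.
Proof.
have [Au|/kapNA->] := pselect (A u); last by rewrite !mulr0.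
rewrite ler_wpM2r ?kap_ge0//; have := sigA Au; rewrite ler_norml => /andP[_].
by lra.
Qed.

Let C_ge0 : 0 <= s0 + delta. Proof. exact: addr_ge0. Qed.

Let noise1 := Rintegral_sum_noise hiid mpsi me mkap kap_ge0 ie e0 n.

Let noise2 := Rintegral_sqr_sum_noise hiid mpsi me mkap kap_ge0 msig sig_ge0 ie
  e0 e2 C_ge0 sig_le n.

Lemma measurable_noise : measurable_fun setT noise.
Proof. by have [/integrable_measurable] := noise1. Qed.

Lemma integrable_noise_sqr : P.-integrable setT (EFin \o (fun w => noise w ^+ 2)).
Proof. by have [] := noise2. Qed.

(** Two replacements: [sig] by [s0], at cost [delta] because the weights vanish off [A], then
    [N * sqr_weights] by its limit value [v], in mean. *)
Lemma noise_sqr L : 0 < L ->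
  `|N * \int[P]_w (noise w ^+ 2) - s0 * v| <=
  delta * v + (s0 + delta) * sqr_weights_error L.
Proof.
move=> L0; have [_ ->] := noise2; have cvE := sqr_weights_cvg L0.
have ic (a : R) : P.-integrable setT (EFin \o (fun _ : Omega => a)).
  exact: (@finite_measure_integrable_cst _ _ _ P).
pose sw w := \sum_(k < n) sig (psi (Z k w)) * W k w ^+ 2.
have isw : P.-integrable setT (EFin \o sw).
  apply: integrable_sumr => k.
  exact: (integrable_sig_weight hiid mpsi mkap kap_ge0 msig sig_ge0 C_ge0 sig_le).
have iNsw := integrable_scale N isw.
have idist := integrable_sqr_weights_dist.
have iq1 := integrable_scale (s0 + delta) idist.
have iq2 := integrable_add (ic (delta * v)) iq1.
have idif := integrable_sub iNsw (ic (s0 * v)).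
have -> : N * \int[P]_w sw w - s0 * v = \int[P]_w (N * sw w - s0 * v).
  rewrite (RintegralB measurableT iNsw (ic _)) (RintegralZl _ measurableT isw).
  by rewrite Rintegral_prob_cst.
apply: (le_trans (le_normr_Rintegral _ idif)) => //.
apply: (@le_trans _ _ (\int[P]_w (delta * v + (s0 + delta) * `|N * sqr_weights w - v|))).
  apply: le_Rintegral => //; first exact: integrable_norm idif.
  move=> w _.
  have sww : `|sw w - s0 * sqr_weights w| <= delta * sqr_weights w.
    rewrite /sw /sqr_weights !mulr_sumr -sumrB (le_trans (ler_norm_sum _ _ _))//.
    apply: ler_sum => k _; rewrite -mulrBl normrM (ger0_norm (sqr_ge0 _)).
    have [Au|/kapNA ku] := pselect (A (psi (Z k w))).
      by rewrite ler_wpM2r ?sqr_ge0// sigA.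
    by rewrite /weight ku mul0r expr0n !mulr0.
  have -> : N * sw w - s0 * v =
      N * (sw w - s0 * sqr_weights w) + s0 * (N * sqr_weights w - v) by ring.
  apply: (le_trans (ler_normD _ _)).
  rewrite (normrM N) (normrM s0) (ger0_norm s0_ge0) (gtr0_norm N_gt0).
  have h1 : N * `|sw w - s0 * sqr_weights w| <= delta * (N * sqr_weights w).
    by rewrite mulrCA; apply: ler_wpM2l => //; exact: ltW.
  have h2 : delta * (N * sqr_weights w) <= delta * (v + `|N * sqr_weights w - v|).
    by rewrite ler_wpM2l// -lerBlDl ler_norm.
  apply: (le_trans (lerD (le_trans h1 h2) (lexx _))).
  by rewrite le_eqVlt; apply/orP; left; apply/eqP; ring.
rewrite RintegralD// Rintegral_prob_cst RintegralZl// lerD2l.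
by rewrite ler_wpM2l.
Qed.

(** * Mean and variance of the estimate *)

Variable r0 : R.

Definition estimate w :=
  (\sum_(k < n) (r0 + rho (psi (Z k w)) + e (Z k w)) * kap (psi (Z k w))) / S w.

(* The last term accounts for the convention that the estimate is [0] when the
   ball contains no observation. *)
Definition bias_part w := D w - (r0 + c) * (S w == 0)%:R.

Lemma estimate_decomposition w : estimate w = r0 + c + (noise w + bias_part w).
Proof.
rewrite /estimate /bias_part.
have [S0|Sn0] := eqVneq (S w) 0.
  have W0 k : W k w = 0 by rewrite /weight -[total_weight _ _ _ _ _]/(S w) S0 invr0 mulr0.
  rewrite S0 invr0 mulr0 mulr1 /noise /fluctuation !big1 => [|k _|k _].
  - by rewrite !add0r subrr.
  - by rewrite W0 mulr0.
  - by rewrite W0 mulr0.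
rewrite mulr0 subr0 /noise /fluctuation.
(* The weights sum to 1 when [S] is nonzero. *)
have -> : r0 + c = (r0 + c) * ((\sum_(k < n) kap (psi (Z k w))) / S w).
  by rewrite divff ?mulr1.
rewrite mulr_suml mulr_suml mulr_sumr -!big_split/=.
by apply: eq_bigr => k _; rewrite /weight; ring.
Qed.

Let zero_le w : (S w == 0)%:R <= lower_tail w.
Proof.
case: eqP => [S0|_]; last exact: lower_tail_ge0.
by rewrite lower_tail_ge1// S0 ltW.
Qed.

Let mzero : measurable_fun setT (fun w => (S w == 0)%:R : R).
Proof.
have -> : (fun w => (S w == 0)%:R : R) = \1_[set w | S w <= 0].
  apply/funext => w; rewrite indicE; congr ((nat_of_bool _)%:R); apply/idP/idP.
    by move=> /eqP S0; rewrite inE /= S0.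
  by rewrite inE/= => S0; rewrite eq_le S0 S_ge0.
by apply: measurable_indic; exact: measurable_sublevel.
Qed.

Let izero : P.-integrable setT (EFin \o (fun w => (S w == 0)%:R : R)).
Proof.
apply: (@integrable_bounded _ _ _ P _ 1) => // w.
by case: (_ == _); rewrite ?normr1 ?normr0.
Qed.

Let Ezero : \int[P]_w ((S w == 0)%:R : R) <= 64 / N ^+ 2.
Proof.
apply: le_trans mean_lower_tail; apply: le_Rintegral => //.
exact: integrable_lower_tail.
Qed.

Let Ezero_ge0 : 0 <= \int[P]_w ((S w == 0)%:R : R).
Proof. by apply: Rintegral_ge0 => w _. Qed.

Let rc_le : `|r0 + c| <= `|r0| + delta.
Proof. by rewrite (le_trans (ler_normD _ _))// lerD2l local_mean_le. Qed.

Lemma integrable_bias_part : P.-integrable setT (EFin \o bias_part).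
Proof.
by apply: integrable_sub; [exact: integrable_fluctuation|exact: integrable_scale].
Qed.

Lemma mean_bias_part : `|\int[P]_w bias_part w| <=
  2 * (4 * delta ^+ 2 + 1) * (k0 / k1) ^+ 2 / N + 128 * delta / N ^+ 2 +
  (`|r0| + delta) * (64 / N ^+ 2).
Proof.
have iz := integrable_scale (r0 + c) izero.
rewrite RintegralB//; last exact: integrable_fluctuation.
rewrite RintegralZl// (le_trans (ler_normB _ _))// lerD ?mean_fluctuation//.
by rewrite normrM (ger0_norm Ezero_ge0); exact: ler_pM.
Qed.

Lemma integrable_bias_part_sqr :
  P.-integrable setT (EFin \o (fun w => bias_part w ^+ 2)).
Proof.
apply: (@integrable_bounded _ _ _ P _ ((2 * delta + `|r0 + c|) ^+ 2)).
  by apply: measurable_funX; exact: integrable_measurable integrable_bias_part.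
move=> w; rewrite normrX lerXn2r ?nnegrE ?addr_ge0 ?mulr_ge0//.
rewrite (le_trans (ler_normB _ _))// lerD ?D_le// normrM ler_piMr//.
by case: (_ == _); rewrite ?normr1 ?normr0.
Qed.

Lemma bias_part_sqr : \int[P]_w (bias_part w ^+ 2) <=
  2 * ((2 * delta) ^+ 2 * ((4 * k0 / k1) ^+ 2 / N + 64 / N ^+ 2)) +
  2 * (`|r0| + delta) ^+ 2 * (64 / N ^+ 2).
Proof.
have i1 := integrable_scale 2 integrable_fluctuation_sqr.
have i2 := integrable_scale (2 * (r0 + c) ^+ 2) izero.
apply: (@le_trans _ _ (\int[P]_w (2 * D w ^+ 2 + 2 * (r0 + c) ^+ 2 * (S w == 0)%:R))).
  apply: le_Rintegral => //.
  - exact: integrable_bias_part_sqr.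
  - exact: integrable_add.
  move=> w _; rewrite /bias_part; case: (_ == _) => /=; last first.
    by rewrite !mulr0 subr0 addr0 ler_peMl ?sqr_ge0// ler1n.
  rewrite !mulr1; move: (D w) (r0 + c) => x y.
  by have := sqr_ge0 (x + y); rewrite !expr2; lra.
have EF := fluctuation_sqr; have iF := integrable_fluctuation_sqr.
rewrite RintegralD// (RintegralZl _ measurableT iF) (RintegralZl _ measurableT izero).
apply: lerD; first by rewrite ler_wpM2l.
apply: ler_pM => //; first by rewrite mulr_ge0 ?sqr_ge0.
rewrite ler_wpM2l// -(real_normK (num_real (r0 + c))) lerXn2r ?nnegrE//.
by rewrite addr_ge0.
Qed.

Lemma integrable_estimate : P.-integrable setT (EFin \o estimate).
Proof.
have -> : estimate = fun w => r0 + c + (noise w + bias_part w).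
  by apply/funext => w; exact: estimate_decomposition.
have [inoise _] := noise1.
apply: integrable_add; first exact: (@finite_measure_integrable_cst _ _ _ P).
exact: (integrable_add inoise integrable_bias_part).
Qed.

Lemma mean_estimate : \int[P]_w estimate w = r0 + c + \int[P]_w bias_part w.
Proof.
have [inoise Enoise] := noise1; have ib := integrable_bias_part.
have ic : P.-integrable setT (EFin \o (fun _ : Omega => r0 + c)).
  exact: (@finite_measure_integrable_cst _ _ _ P).
have inb := integrable_add inoise ib.
transitivity (\int[P]_w (r0 + c + (noise w + bias_part w))).
  by apply: eq_Rintegral => w _; exact: estimate_decomposition.
rewrite (RintegralD measurableT ic inb) Rintegral_prob_cst.
have En : \int[P]_w noise w = 0 by exact: Enoise.
by rewrite (RintegralD measurableT inoise ib) En add0r.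
Qed.

(** As the noise has mean 0, centering the estimate only centers [bias_part], which does not
    increase its second moment. The cross term is bounded by AM-GM with parameter [eta]: the bias
    part being of smaller order than the noise, a small [eta] makes both errors negligible. *)
Lemma variance_estimate eta : 0 < eta ->
  P.-integrable setT (EFin \o (fun w => (estimate w - \int[P]_w estimate w) ^+ 2)) /\
  `|\int[P]_w ((estimate w - \int[P]_w estimate w) ^+ 2) - \int[P]_w (noise w ^+ 2)|
  <= eta * \int[P]_w (noise w ^+ 2) + (eta^-1 + 1) * \int[P]_w (bias_part w ^+ 2).
Proof.
move=> eta0; set b := \int[P]_w bias_part w.
have ib := integrable_bias_part; have ib2 := integrable_bias_part_sqr.
have in2 := integrable_noise_sqr; have mn := measurable_noise.
have mb : measurable_fun setT bias_part by exact: integrable_measurable ib.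
have ic (a : R) : P.-integrable setT (EFin \o (fun _ : Omega => a)).
  exact: (@finite_measure_integrable_cst _ _ _ P).
pose g w := bias_part w - b.
have mg : measurable_fun setT g by exact: measurable_funB.
have i2b := integrable_scale (2 * b) ib.
have i2bb := integrable_sub i2b (ic (b ^+ 2)).
have g2E : (fun w => g w ^+ 2) =
    (fun w => bias_part w ^+ 2 - (2 * b * bias_part w - b ^+ 2)).
  by apply/funext => w; rewrite /g; ring.
have ig2 : P.-integrable setT (EFin \o (fun w => g w ^+ 2)).
  by rewrite g2E; exact: integrable_sub.
have Eg2 : \int[P]_w (g w ^+ 2) <= \int[P]_w (bias_part w ^+ 2).
  rewrite g2E (RintegralB measurableT ib2 i2bb) (RintegralB measurableT i2b (ic _)).
  rewrite (RintegralZl _ measurableT ib) -/b Rintegral_prob_cst.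
  by rewrite gerBl; have := sqr_ge0 b; rewrite expr2; lra.
have VE : (fun w => (estimate w - \int[P]_w estimate w) ^+ 2) =
    (fun w => noise w ^+ 2 + (2 * (noise w * g w) + g w ^+ 2)).
  by apply/funext => w; rewrite mean_estimate estimate_decomposition -/b /g; ring.
have ing := integrable_mul_sqr mn mg in2 ig2.
have i2ng := integrable_scale 2 ing.
have i2ngg := integrable_add i2ng ig2.
rewrite VE; split; first exact: integrable_add.
rewrite (RintegralD measurableT in2 i2ngg) addrAC subrr add0r.
apply: (le_trans (le_normr_Rintegral measurableT i2ngg)).
have i3 := integrable_scale eta in2; have i4 := integrable_scale (eta^-1 + 1) ig2.
apply: (@le_trans _ _ (\int[P]_w (eta * noise w ^+ 2 + (eta^-1 + 1) * g w ^+ 2))).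
  apply: le_Rintegral => //.
  - exact: integrable_norm i2ngg.
  - exact: integrable_add.
  move=> w _; rewrite (le_trans (ler_normD _ _))// (ger0_norm (sqr_ge0 (g w))).
  rewrite normrM ger0_norm// normrM.
  rewrite -(real_normK (num_real (noise w))) -(real_normK (num_real (g w))).
  move: `|noise w| `|g w| => x y.
  have : 0 <= (eta * x - y) ^+ 2 / eta by rewrite divr_ge0 ?sqr_ge0// ltW.
  have -> : (eta * x - y) ^+ 2 / eta = eta * x ^+ 2 - 2 * (x * y) + eta^-1 * y ^+ 2.
    by field; rewrite gt_eqF.
  by lra.
rewrite (RintegralD measurableT i3 i4) (RintegralZl _ measurableT in2).
rewrite (RintegralZl _ measurableT ig2) lerD2l ler_wpM2l//.
by rewrite addr_ge0// invr_ge0 ltW.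
Qed.


(** Obtained from [mean_bias_part] by replacing [delta] by 1 and [1 / N^2] by [1 / N]; in particular
    [10 = 2 * (4 + 1)]. *)
Definition bias_cst := 10 * (k0 / k1) ^+ 2 + 128 + 64 * (`|r0| + 1).

Lemma mean_bias_part_rate : delta <= 1 -> 1 <= N ->
  `|\int[P]_w bias_part w| <= bias_cst / N.
Proof.
move=> d1 N1; apply: (le_trans mean_bias_part).
have iN0 : 0 <= N^-1 by rewrite invr_ge0 ltW.
have NN : N ^- 2 <= N^-1.
  by rewrite lef_pV2 ?posrE ?exprn_gt0// expr2 ler_peMl// ltW.
have d2 : delta ^+ 2 <= 1 by rewrite expr_le1.
have -> : bias_cst / N = 2 * (4 * 1 + 1) * (k0 / k1) ^+ 2 / N + 128 * 1 / N +
    (`|r0| + 1) * (64 / N) by rewrite /bias_cst; ring.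
apply: lerD; last first.
  by apply: ler_pM; rewrite ?addr_ge0 ?lerD2l// ?divr_ge0 ?sqr_ge0// ler_wpM2l.
apply: lerD.
  rewrite ler_wpM2r// ler_wpM2r ?sqr_ge0//.
  by rewrite ler_wpM2l// lerD2r ler_wpM2l.
by apply: ler_pM; rewrite ?mulr_ge0 ?invr_ge0 ?sqr_ge0// ler_wpM2l.
Qed.

(** The factor of [delta] in [sqr_weights_error] at [L = 1 / delta], when [1 / N <= delta^2] and
    [delta <= 1]. *)
Definition error_cst :=
  8 / k1 ^+ 2 * (k0 ^+ 4 + 1) + 16 * k0 ^+ 2 / k1 ^+ 4 * k0 ^+ 2 +
  16 * k0 ^+ 3 / k1 ^+ 4 * (k0 ^+ 2 + 1) + 64 * (1 + (k0 / k1) ^+ 2).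

Let noise_cst := (k0 / k1) ^+ 2 + (s0 + 1) * error_cst.

Let bias_sqr_cst := 8 * ((4 * k0 / k1) ^+ 2 + 64) + 128 * (`|r0| + 1) ^+ 2.

(** The first two terms bound [N] times the second moment of the noise, which gets the factor
    [eta = delta]; [2 * bias_sqr_cst] comes from the bias part, and the last [noise_cst] from the
    distance of the noise term to its limit. *)
Definition variance_rate_cst :=
  s0 * (k0 / k1) ^+ 2 + noise_cst + 2 * bias_sqr_cst + noise_cst.

(* All free parameters ([delta], [eta], [1 / L]) are set to [delta]. *)
Section rate.
Hypotheses (delta_gt0 : 0 < delta) (delta_le1 : delta <= 1).
Hypothesis N_large : delta ^- 2 <= N.

Let iN : N^-1 <= delta ^+ 2.
Proof. by rewrite -[leRHS]invrK lef_pV2 ?posrE ?invr_gt0 ?exprn_gt0. Qed.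

Let d2 : delta ^+ 2 <= delta. Proof. by rewrite expr2 ler_piMl. Qed.

Let iN1 : N^-1 <= delta. Proof. exact: le_trans d2. Qed.

Let iN0 : 0 <= N^-1. Proof. by rewrite invr_ge0 ltW. Qed.

Let iNN : N ^- 2 <= delta ^+ 2.
Proof.
rewrite -exprVn; apply: le_trans iN; rewrite expr2 ler_piMl//.
exact: le_trans iN1 delta_le1.
Qed.

Let k0_ge0 : 0 <= k0. Proof. by rewrite ltW// k0_gt0. Qed.

Let k1_ge0 : 0 <= k1. Proof. exact: ltW. Qed.

Let sqr_weights_error_rate : sqr_weights_error delta^-1 <= error_cst * delta.
Proof.
(* This balance dictates the threshold [delta^-2] on [N]: with [L = 1 / delta], both [1 / L] and
   [L / N] are at most [delta]. *)
have iNd : delta^-1 * N^-1 <= delta by rewrite mulrC ler_pdivrMr// -expr2.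
have a1 : 0 <= 8 / k1 ^+ 2 by rewrite divr_ge0 ?exprn_ge0.
have a2 : 0 <= 16 * k0 ^+ 2 / k1 ^+ 4.
  by rewrite divr_ge0 ?mulr_ge0 ?exprn_ge0.
have a3 : 0 <= 16 * k0 ^+ 3 / k1 ^+ 4.
  by rewrite divr_ge0 ?mulr_ge0 ?exprn_ge0.
have kN j : delta^-1 * (k0 ^+ j / N) <= k0 ^+ j * delta.
  by rewrite mulrCA ler_wpM2l ?exprn_ge0.
rewrite /sqr_weights_error invrK /error_cst.
set b1 := 8 / k1 ^+ 2 in a1 *; set b2 := 16 * k0 ^+ 2 / k1 ^+ 4 in a2 *.
set b3 := 16 * k0 ^+ 3 / k1 ^+ 4 in a3 *.
have -> : (b1 * (k0 ^+ 4 + 1) + b2 * k0 ^+ 2 + b3 * (k0 ^+ 2 + 1) +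
    64 * (1 + (k0 / k1) ^+ 2)) * delta =
    b1 * (k0 ^+ 4 * delta + delta) + b2 * (k0 ^+ 2 * delta) +
    b3 * (k0 ^+ 2 * delta + delta) +
    (64 * delta + (k0 / k1) ^+ 2 * (64 * delta)) by ring.
have NN : N * (64 / N ^+ 2) = 64 * N^-1.
  have [nn Fn] := (gt_eqF n_gt0, gt_eqF F_gt0).
  by field; rewrite ?nn ?Fn.
rewrite [(N + _) * _]mulrDl NN; apply: lerD; first apply: lerD; first apply: lerD.
- by apply: ler_wpM2l => //; apply: lerD => //; exact: kN.
- by apply: ler_wpM2l => //; apply: ler_wpM2l => //; exact: exprn_ge0.
- by apply: ler_wpM2l => //; apply: lerD => //; exact: kN.
apply: lerD; first exact: ler_wpM2l.
apply: ler_wpM2l; first exact: sqr_ge0.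
by apply: ler_wpM2l => //; exact: le_trans iNN d2.
Qed.

Let error_cst_ge0 : 0 <= error_cst.
Proof.
rewrite /error_cst; do ![apply: addr_ge0 | apply: divr_ge0 | apply: mulr_ge0 |
  apply: exprn_ge0 | exact: k0_ge0 | exact: k1_ge0 | by []].
Qed.

Let noise_rate : `|N * \int[P]_w (noise w ^+ 2) - s0 * v| <= noise_cst * delta.
Proof.
have L0 : 0 < delta^-1 by rewrite invr_gt0.
apply: (le_trans (noise_sqr L0)).
have /andP[v0 vk] := sqr_weights_limit_bounds.
rewrite /noise_cst [leRHS]mulrDl; apply: lerD.
  by rewrite mulrC ler_wpM2r.
rewrite -[leRHS]mulrA; apply: ler_pM => //; last by rewrite lerD2l.
apply: (le_trans _ (sqr_weights_cvg L0)).
by apply: Rintegral_ge0 => w _.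
Qed.

Let bias_sqr_rate : N * \int[P]_w (bias_part w ^+ 2) <= bias_sqr_cst * delta ^+ 2.
Proof.
apply: (le_trans (ler_wpM2l (ltW N_gt0) bias_part_sqr)).
have [nn Fn] := (gt_eqF n_gt0, gt_eqF F_gt0).
have -> : N * (2 * ((2 * delta) ^+ 2 * ((4 * k0 / k1) ^+ 2 / N + 64 / N ^+ 2)) +
    2 * (`|r0| + delta) ^+ 2 * (64 / N ^+ 2)) =
  8 * ((4 * k0 / k1) ^+ 2 + 64 / N) * delta ^+ 2 +
    128 * (`|r0| + delta) ^+ 2 / N.
  by field; rewrite ?nn ?Fn ?(gt_eqF k1_gt0).
rewrite /bias_sqr_cst [leRHS]mulrDl; apply: lerD.
  rewrite ler_wpM2r ?sqr_ge0// ler_wpM2l// lerD2l ler_piMr//.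
  exact: le_trans iN1 delta_le1.
apply: ler_pM => //; first by rewrite mulr_ge0 ?sqr_ge0.
by rewrite ler_wpM2l// lerXn2r ?nnegrE ?addr_ge0// lerD2l.
Qed.

Lemma variance_rate :
  `|N * \int[P]_w ((estimate w - \int[P]_w estimate w) ^+ 2) - s0 * v| <=
  variance_rate_cst * delta.
Proof.
have [_ H] := variance_estimate delta_gt0.
have /andP[v0 vk] := sqr_weights_limit_bounds.
set V := \int[P]_w _ in H *; set A2 := \int[P]_w (noise w ^+ 2) in H.
set B2 := \int[P]_w (bias_part w ^+ 2) in H.
have n1 : `|N * A2 - s0 * v| <= noise_cst * delta := noise_rate.
have n2 : N * A2 <= s0 * (k0 / k1) ^+ 2 + noise_cst.
  have -> : N * A2 = s0 * v + (N * A2 - s0 * v) by ring.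
  rewrite lerD ?ler_wpM2l//; apply: (le_trans (ler_norm _)).
  apply: (le_trans n1); rewrite ler_piMr//.
  by rewrite addr_ge0 ?sqr_ge0// mulr_ge0// addr_ge0.
have n3 : N * B2 <= bias_sqr_cst * delta ^+ 2 := bias_sqr_rate.
have -> : N * V - s0 * v = N * (V - A2) + (N * A2 - s0 * v) by ring.
rewrite /variance_rate_cst [leRHS]mulrDl; apply: (le_trans (ler_normD _ _)).
apply: lerD => //.
rewrite normrM (gtr0_norm N_gt0).
apply: (le_trans (ler_wpM2l (ltW N_gt0) H)).
rewrite mulrDr [leRHS]mulrDl; apply: lerD.
  by rewrite mulrCA [leRHS]mulrC ler_wpM2l.
rewrite mulrCA.
apply: (@le_trans _ _ ((delta^-1 + 1) * (bias_sqr_cst * delta ^+ 2))).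
  by rewrite ler_wpM2l// addr_ge0// invr_ge0.
have b0 : 0 <= bias_sqr_cst.
  by rewrite addr_ge0 ?mulr_ge0 ?addr_ge0 ?sqr_ge0.
(* The order [delta^2] of the bias part compensates the factor [1 / eta = 1 / delta]. *)
have -> : (delta^-1 + 1) * (bias_sqr_cst * delta ^+ 2) =
    bias_sqr_cst * (delta + delta ^+ 2).
  by field; rewrite gt_eqF.
have -> : 2 * bias_sqr_cst * delta = bias_sqr_cst * (delta + delta) by ring.
by rewrite ler_wpM2l// lerD2l.
Qed.

End rate.

End bounds.

(** * Conditional expectations, derivatives at endpoints, Borel functions *)

Section conditional_expectation.
Context (d d' : measure_display) (Omega : measurableType d)
  (T : measurableType d') (R : realType) (P : probability Omega R).

(** The difference [V - g (X)] has null integrals over preimages under [X], so its two parts have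
    equal weighted integrals. With the distance to [chi] as conditioning variable, this replaces
    [r (X) - r chi] by [phi]. *)
Lemma Rintegral_cond_expectation (V : Omega -> R) (X : Omega -> T) (g : T -> R)
    (k : T -> R) (B : R) :
  measurable_fun setT X -> is_cond_expectation P V X g ->
  measurable_fun setT k -> (forall x, 0 <= k x <= B) ->
  \int[P]_w (V w * k (X w)) = \int[P]_w (g (X w) * k (X w)).
Proof.
move=> mX [iV mg ig Vg] mk kB.
have k0 x : 0 <= k x by have /andP[] := kB x.
pose f w := V w - g (X w).
have ifi : P.-integrable setT (EFin \o f) by exact: integrable_sub.
have mf := integrable_measurable ifi.
have mkX : measurable_fun setT (fun w => k (X w)) by exact: measurableT_comp.
have ikf (u : Omega -> R) : P.-integrable setT (EFin \o u) ->
    P.-integrable setT (EFin \o (fun w => u w * k (X w))).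
  move=> iu; have mu := integrable_measurable iu.
  apply: (integrable_dominated (g := fun w => B * `|u w|)).
  - exact: measurable_funM.
  - move=> w; rewrite normrM mulrC ler_wpM2r// ger0_norm//.
    by have /andP[] := kB (X w).
  - by apply: integrable_scale; exact: integrable_norm iu.
have f0 C : measurable C -> (\int[P]_(w in X @^-1` C) (f^\+ w)%:E =
    \int[P]_(w in X @^-1` C) (f^\- w)%:E)%E.
  move=> mC; set D := _ @^-1` C.
  have mD : measurable D by rewrite -[X in measurable X]setTI; exact: mX.
  have iD u : P.-integrable setT (EFin \o u) -> P.-integrable D (EFin \o u).
    by move=> iu; exact: integrableS iu.
  have : (\int[P]_(w in D) (f w)%:E = 0)%E.
    under eq_integral do rewrite EFinB.
    rewrite integralB//; [|exact: iD..].
    rewrite (Vg _ mC) subee//; apply: integrable_fin_num => //; exact: iD.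
  exact: eq_integral_funrpos_funrneg mD (iD _ ifi).
have E0 : \int[P]_w (f w * k (X w)) = 0.
  transitivity (\int[P]_w (f^\+ w * k (X w) - f^\- w * k (X w))).
    apply: eq_Rintegral => w _; rewrite -mulrBl.
    by rewrite -[in LHS](funrposBneg f).
  have ip := integrable_funrpos measurableT ifi.
  have im := integrable_funrneg measurableT ifi.
  rewrite RintegralB//; [|exact: ikf..].
  rewrite /Rintegral (ge0_integral_weighted_eq mX _ _ _ _ f0 mk k0) ?subrr//.
  - exact: measurable_funrpos.
  - exact: measurable_funrneg.
have ikV := ikf _ iV; have ikg := ikf _ ig.
apply/eqP; rewrite -subr_eq0 -(RintegralB measurableT ikV ikg) -E0; apply/eqP.
by apply: eq_Rintegral => w _; rewrite mulrBl.
Qed.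

End conditional_expectation.

(** At 0 and 1 [derive1] carries no information, but the endpoints are negligible; the constants of
    the statement thus become the limits found by integration by parts. *)
Lemma Rintegral_derive1 (R : realType) (G g t : R -> R) :
  C1_unit_interval G g -> measurable_fun `[(0 : R), 1] t ->
  \int[@lebesgue_measure R]_(s in `[0, 1]) (derive1 G s * t s) =
  \int[@lebesgue_measure R]_(s in `[0, 1]) (g s * t s).
Proof.
move=> [_ dG _ ig] mt; apply: eq_Rintegral_itv_oo => [|s s01].
  apply: measurable_funM; first by case/integrableP : ig => /measurable_EFinP.
  by apply: measurable_funS mt => //; exact: subset_itv_oo_cc.
by have dGs := dG s s01; rewrite derive1E derive_val.
Qed.

Lemma measurable_continuous_borel (R : realType) (E : completeNormedModType R)
  (f : E -> R) : continuous f -> measurable_fun setT (f : borel E -> R).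
Proof.
move=> cf; apply: (measurability _ (RGenOpens.measurableE R)).
move=> _ [_ [a [b ->] <-]]; rewrite setTI; apply: sub_sigma_algebra.
by move/continuousP : cf; apply; exact: interval_open.
Qed.

(** * Asymptotics *)

Section asymptotics.
Context (R : realType) (d : measure_display) (Omega : measurableType d)
  (P : probability Omega R) (E : completeNormedModType R).
Variables (Y_ : nat -> Omega -> R) (X_ : nat -> Omega -> E)
  (Y : Omega -> R) (X : Omega -> E).

Local Notation Z := (fun (i : nat) (w : Omega) => (Y_ i w, X_ i w : borel E)).
Local Notation Z0 := (fun w : Omega => (Y w, X w : borel E)).
Local Notation psi := (@snd R (borel E)).

Hypothesis hiid : iid_copies P Z Z0.
Variables (r sigma2 : E -> R).
Hypothesis r_meas : measurable_fun setT (r : borel E -> R).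
Variable eps : nat -> Omega -> R.
Hypothesis hmodel : forall i w, Y_ i w = r (X_ i w) + eps i w.
Hypothesis heps : forall i,
  is_cond_expectation P (eps i) (X_ i : Omega -> borel E) (fun=> 0).
Hypothesis heps2 : forall i,
  is_ge0_cond_expectation P (fun w => eps i w ^+ 2)
    (X_ i : Omega -> borel E) sigma2.
Variables (chi : E) (phi : R -> R).
Hypothesis hphi : is_cond_expectation P (fun w => r (X w) - r chi)
  (fun w => `|X w - chi|) phi.
Hypothesis phi0 : phi 0 = 0.
Hypothesis r_cont : {for chi, continuous r}.
Hypothesis sigma2_cont : {for chi, continuous sigma2}.
Variable dphi : R.
Hypothesis hdphi : has_derivative_within `[0, +oo[ phi 0 dphi.
Variable h : nat -> R.
Hypotheses (h_gt0 : forall n, 0 < h n) (h_cvg0 : h n @[n --> \oo] --> (0 : R)).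
Local Notation F := (small_ball P X chi).
Hypothesis nF_cvgy : n%:R * F (h n) @[n --> \oo] --> +oo.
Variable K : R -> R.
Hypothesis hK : admissible_kernel K.
Variable tau0 : R -> R.
Hypothesis htau : forall s, 0 <= s <= 1 -> tau F t s @[t --> 0^'+] --> tau0 s.

Let kap n : borel E -> R := fun x => K ((h n)^-1 * `|x - chi|).
Let A n : set (borel E) := [set x : borel E | `|x - chi| <= h n].
Let rho : borel E -> R := fun x => r x - r chi.
(** The noise is expressed through the observed pair because independence and equality in law are
    given for the pairs, not for [eps]. *)
Let e : R * borel E -> R := fun z => z.1 - r z.2.
Let D (w : Omega) := `|X w - chi|.

Let mpsi : measurable_fun setT psi. Proof. exact: measurable_snd. Qed.

Let mdist : measurable_fun setT (fun x : borel E => `|x - chi|).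
Proof.
apply: (measurable_continuous_borel (f := fun x : E => `|x - chi|)) => x.
by apply: cvg_norm; apply: cvgB => //; exact: cvg_cst.
Qed.

Let mkap n : measurable_fun setT (kap n).
Proof.
apply: (measurableT_comp (measurable_admissible_kernel hK)).
exact: measurable_funM.
Qed.

Let mX : measurable_fun setT (X : Omega -> borel E).
Proof. by have [/(measurableT_comp measurable_snd)] := hiid. Qed.

Let mD : measurable_fun setT D. Proof. exact: (measurableT_comp mdist mX). Qed.

Let D_ge0 w : 0 <= D w. Proof. exact: normr_ge0. Qed.

Let mA n : measurable (A n). Proof. exact: measurable_sublevel. Qed.

Let K1_gt0 : 0 < K 1. Proof. by have [] := hK. Qed.

Let scaled n (x : E) : `|x - chi| <= h n -> 0 <= (h n)^-1 * `|x - chi| <= 1.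
Proof.
move=> xh; rewrite mulr_ge0 ?invr_ge0 ?(ltW (h_gt0 n))//=.
by rewrite mulrC ler_pdivrMr// mul1r.
Qed.

Let kapA n u : A n u -> K 1 <= kap n u <= K 0.
Proof. by move=> /scaled; exact: admissible_kernel_range. Qed.

Let kapNA n u : ~ A n u -> kap n u = 0.
Proof.
move=> /negP; rewrite -ltNge => uh; have [K0 _ _ _] := hK; apply: K0.
rewrite negb_and -!ltNge; apply/orP; right.
by rewrite mulrC ltr_pdivlMr// mul1r.
Qed.

Let mrho : measurable_fun setT rho. Proof. exact: measurable_funB. Qed.

Let me : measurable_fun setT e.
Proof.
by apply: measurable_funB => //; exact: (measurableT_comp r_meas measurable_snd).
Qed.

Let eE k : (fun w => e (Z k w)) = eps k.
Proof. by apply/funext => w; rewrite /e/= hmodel addrC addKr. Qed.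

Let ie k : P.-integrable setT (EFin \o (fun w => e (Z k w))).
Proof. by rewrite eE; have [] := heps k. Qed.

Let e0 k B : measurable B ->
  (\int[P]_(w in (fun w => psi (Z k w)) @^-1` B) (e (Z k w))%:E = 0)%E.
Proof.
move=> mB; have [_ _ _ /(_ B mB) H] := heps k.
transitivity (\int[P]_(w in (X_ k : Omega -> borel E) @^-1` B) (eps k w)%:E)%E.
  by apply: eq_integral => w _; rewrite -(eE k).
by rewrite H; apply: integral0_eq.
Qed.

Let e2 k B : measurable B ->
  (\int[P]_(w in (fun w => psi (Z k w)) @^-1` B) (e (Z k w) ^+ 2)%:E =
   \int[P]_(w in (fun w => psi (Z k w)) @^-1` B) (sigma2 (psi (Z k w)))%:E)%E.
Proof.
move=> mB; have [_ _ /(_ B mB) <-] := heps2 k.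
by apply: eq_integral => w _; rewrite -(eE k).
Qed.

Let msig : measurable_fun setT (sigma2 : borel E -> R).
Proof. by have [_ []] := heps2 0. Qed.

Let sig_ge0 u : 0 <= sigma2 u. Proof. by have [_ [_]] := heps2 0. Qed.

Let rhat n := kernel_estimate K Y_ X_ chi (h n) n.

Let rhatE n : rhat n = estimate Z psi (kap n) n rho e (r chi).
Proof.
apply/funext => w; rewrite /rhat /kernel_estimate /estimate; congr (_ / _).
by apply: eq_bigr => k _; rewrite /rho /e /kap/=; congr (_ * _); ring.
Qed.

Let N n := n%:R * F (h n).

Let N_ge c : \forall n \near \oo, c <= N n.
Proof. by move/cvgryPge : nF_cvgy => /(_ c). Qed.

Let N_gt0 : \forall n \near \oo, 0 < N n.
Proof. by move/cvgryPgt : nF_cvgy => /(_ 0). Qed.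

Let F_gt0 : \forall n \near \oo, 0 < F (h n).
Proof.
near=> n; have : 0 < N n by near: n; exact: N_gt0.
move=> N0; rewrite lt_neqAle fine_ge0// andbT.
by apply/eqP => Fn0; move: N0; rewrite /N -Fn0 mulr0 ltxx.
Unshelve. all: by end_near. Qed.

Let rho_small t : 0 < t -> \forall n \near \oo, forall u, A n u -> `|rho u| <= t.
Proof.
move=> t0; move/cvgrPdist_lt : r_cont => /(_ t t0) /nbhs_ballP[b /= b0 br].
near=> n => u Au; rewrite /rho distrC; apply/ltW/br.
rewrite -ball_normE /= distrC (le_lt_trans Au)//.
by near: n; exact: (cvgr_lt _ h_cvg0).
Unshelve. all: by end_near. Qed.

Let sigma2_small t : 0 < t ->
  \forall n \near \oo, forall u, A n u -> `|sigma2 u - sigma2 chi| <= t.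
Proof.
move=> t0; move/cvgrPdist_lt : sigma2_cont => /(_ t t0) /nbhs_ballP[b /= b0 br].
near=> n => u Au; rewrite distrC; apply/ltW/br.
rewrite -ball_normE /= distrC (le_lt_trans Au)//.
by near: n; exact: (cvgr_lt _ h_cvg0).
Unshelve. all: by end_near. Qed.

Let K_off s : ~~ (0 <= s <= 1) -> K s = 0.
Proof. by have [+ _ _ _] := hK; apply. Qed.

Let mtau0 : measurable_fun `[(0 : R), 1] tau0.
Proof. exact: (measurable_tau0 mD h_gt0 h_cvg0 htau). Qed.

Let mean n := \int[P]_w kap n (X w).

Let mean_cvg : mean n / F (h n) @[n --> \oo] --> M1 K tau0.
Proof.
have [K' rK _] := admissible_kernelE hK.
rewrite /M1 (Rintegral_derive1 rK mtau0).
exact: (kernel_moment_cvg mD D_ge0 h_gt0 h_cvg0 htau rK K_off F_gt0).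
Qed.

Let mean_sqr_cvg : (\int[P]_w (kap n (X w) ^+ 2)) / F (h n) @[n --> \oo] --> M2 K tau0.
Proof.
have [K' rK _] := admissible_kernelE hK.
have rK2 := C1_unit_intervalM rK rK.
rewrite /M2 (_ : (fun u => K u ^+ 2) = fun u => K u * K u); last first.
  by apply/funext => u; rewrite expr2.
rewrite (Rintegral_derive1 rK2 mtau0).
have off s : ~~ (0 <= s <= 1) -> K s * K s = 0 by move=> /K_off ->; rewrite mul0r.
have := kernel_moment_cvg mD D_ge0 h_gt0 h_cvg0 htau rK2 off F_gt0.
rewrite expr2; apply: cvg_trans; apply: near_eq_cvg; apply: nearW => n.
by congr (_ / _); apply: eq_Rintegral => w _; rewrite expr2.
Qed.

Let mean_id_cvg :
  (\int[P]_w ((h n)^-1 * D w * K ((h n)^-1 * D w))) / F (h n) @[n --> \oo] -->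
  M0 K tau0.
Proof.
have [K' rK _] := admissible_kernelE hK.
have rK0 := C1_unit_intervalM (C1_unit_interval_id R) rK.
rewrite /M0 (Rintegral_derive1 rK0 mtau0).
have off (s : R) : ~~ (0 <= s <= 1) -> id s * K s = 0 by move=> /K_off ->; rewrite mulr0.
have := kernel_moment_cvg mD D_ge0 h_gt0 h_cvg0 htau rK0 off F_gt0.
by rewrite mul1r.
Qed.

Let mean_lb : \forall n \near \oo, K 1 * F (h n) <= mean n.
Proof.
near=> n; have Nn : 0 < N n by near: n; exact: N_gt0.
exact: (mean_kap_lb hiid mpsi (mkap n) (mA n) K1_gt0 (@kapA n) (@kapNA n) Nn).
Unshelve. all: by end_near. Qed.

Let mean_gt0 : \forall n \near \oo, 0 < mean n.
Proof.
near=> n; apply: (@lt_le_trans _ _ (K 1 * F (h n))); last by near: n; exact: mean_lb.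
by rewrite mulr_gt0//; near: n; exact: F_gt0.
Unshelve. all: by end_near. Qed.

(** As a limit of ratios that are at least [K 1]; this legitimates the quotients by [M1]. *)
Let M1_gt0 : 0 < M1 K tau0.
Proof.
apply: (lt_le_trans K1_gt0); rewrite -(cvg_lim _ mean_cvg)//.
apply: limr_ge; first by apply/cvg_ex; eexists; exact: mean_cvg.
near=> n; rewrite ler_pdivlMr; first by near: n; exact: mean_lb.
by near: n; exact: F_gt0.
Unshelve. all: by end_near. Qed.

Let c n := local_mean P Z0 psi (kap n) rho.

(** The difference quotient is multiplied out so that [s = 0] is included, by [phi 0 = 0]. *)
Let phi_near t : 0 < t -> exists2 b, 0 < b &
  forall s, 0 <= s < b -> `|phi s - dphi * s| <= t * s.
Proof.
move=> t0; move/cvgrPdist_lt : hdphi => /(_ t t0) /nbhs_ballP[b /= b0 br].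
exists b => // s /andP[]; rewrite le_eqVlt => /predU1P[<- _|s0 sb].
  by rewrite phi0 !mulr0 subrr normr0.
have := br s; rewrite -ball_normE /= sub0r normrN gtr0_norm// => /(_ sb).
rewrite gt_eqF// => /(_ isT); rewrite in_itv/= (ltW s0) => /(_ isT).
rewrite phi0 !subr0 => /ltW H.
have -> : phi s - dphi * s = - (dphi - phi s / s) * s by field; rewrite gt_eqF.
by rewrite normrM normrN (gtr0_norm s0) ler_wpM2r// ltW.
Qed.

Let kD n w := K ((h n)^-1 * D w).

Let mkD n : measurable_fun setT (kD n).
Proof. exact: (measurableT_comp (mkap n) mX). Qed.

Let kD_le n w : `|kD n w| <= K 0.
Proof.
by rewrite ger0_norm ?(admissible_kernel_ge0 hK) ?(admissible_kernel_le hK).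
Qed.

Let ikD n : P.-integrable setT (EFin \o kD n).
Proof. exact: integrable_bounded (mkD n) (kD_le n). Qed.

Let iid_kD n : P.-integrable setT (EFin \o (fun w => (h n)^-1 * D w * kD n w)).
Proof.
apply: (@integrable_bounded _ _ _ P _ (K 0)).
  by apply: measurable_funM => //; exact: measurable_funM.
move=> w; have [Dh|/kapNA Dh] := pselect (A n (X w)).
  have /andP[s0 s1] := scaled Dh.
  rewrite normrM ger0_norm// -[leRHS]mul1r.
  by apply: ler_pM => //; exact: kD_le.
by rewrite /kD -[K _]/(kap n (X w)) Dh mulr0 normr0 (le_trans _ (kD_le n w)).
Qed.

Let iphi_kD n : P.-integrable setT (EFin \o (fun w => phi (D w) * kD n w)).
Proof.
have [_ mphi iphi _] := hphi.
apply: (integrable_dominated (g := fun w => K 0 * `|phi (D w)|)).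
- by apply: measurable_funM => //; exact: measurableT_comp.
- by move=> w; rewrite normrM mulrC ler_wpM2r.
- by apply: integrable_scale; exact: integrable_norm iphi.
Qed.

Let local_mean_cvg : c n / h n @[n --> \oo] --> dphi * (M0 K tau0 / M1 K tau0).
Proof.
pose J n := \int[P]_w (phi (D w) * kD n w).
pose I n := \int[P]_w ((h n)^-1 * D w * kD n w).
have cE n : c n = J n / mean n.
  rewrite /c /local_mean; congr (_ / _).
  apply: (@Rintegral_cond_expectation _ _ _ _ _ P (fun w => r (X w) - r chi)
    D phi (fun s => K ((h n)^-1 * s)) (K 0) mD hphi).
    apply: (measurableT_comp (measurable_admissible_kernel hK)).
    exact: measurable_funM.
  by move=> s; rewrite (admissible_kernel_ge0 hK) (admissible_kernel_le hK).
(* The factors [F (h n)] cancel; they are kept because only the normalized moments converge. *)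
have cvIm : dphi * ((I n / F (h n)) / (mean n / F (h n))) @[n --> \oo] -->
    dphi * (M0 K tau0 / M1 K tau0).
  apply: cvgM; first exact: cvg_cst.
  apply: cvgM; first exact: mean_id_cvg.
  by apply: cvgV; [rewrite gt_eqF|exact: mean_cvg].
(* On the ball [|phi D - dphi D| <= t D <= t h], so the numerator of the difference is at most [t h]
   times the mean of the kernel. *)
have dif : c n / h n - dphi * ((I n / F (h n)) / (mean n / F (h n)))
    @[n --> \oo] --> (0 : R).
  apply/cvgr0Pnorm_le => t t0; have [b b0 phib] := phi_near t0.
  near=> n.
  have hn0 := h_gt0 n.
  have Fn0 : 0 < F (h n) by near: n; exact: F_gt0.
  have mn0 : 0 < mean n by near: n; exact: mean_gt0.
  have hb : h n < b by near: n; exact: (cvgr_lt _ h_cvg0).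
  have iI := integrable_scale (dphi * h n) (iid_kD n).
  have -> : c n / h n - dphi * ((I n / F (h n)) / (mean n / F (h n))) =
      (J n - dphi * h n * I n) / (h n * mean n).
    by rewrite cE; field; rewrite !gt_eqF.
  have hm0 : 0 < h n * mean n by rewrite mulr_gt0.
  rewrite normrM normfV (gtr0_norm hm0) ler_pdivrMr//.
  rewrite -(RintegralZl _ measurableT (iid_kD n)).
  rewrite -(RintegralB measurableT (iphi_kD n) iI).
  have idif := integrable_sub (iphi_kD n) iI.
  apply: (le_trans (le_normr_Rintegral measurableT idif)).
  rewrite mulrA -(RintegralZl _ measurableT (ikD n)).
  apply: le_Rintegral => //.
  - exact: integrable_norm idif.
  - exact: integrable_scale.
  move=> w _; have [Dh|/kapNA Dh] := pselect (A n (X w)); last first.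
    by rewrite /kD -[K _]/(kap n (X w)) Dh !mulr0 subrr normr0.
  have -> : phi (D w) * kD n w - dphi * h n * ((h n)^-1 * D w * kD n w) =
      (phi (D w) - dphi * D w) * kD n w by field; rewrite gt_eqF.
  rewrite normrM (ger0_norm (admissible_kernel_ge0 hK _)).
  apply: ler_wpM2r; first exact: (admissible_kernel_ge0 hK).
  apply: (@le_trans _ _ (t * D w)).
    by apply: phib; rewrite D_ge0/= (le_lt_trans Dh).
  by rewrite ler_wpM2l// ltW.
have -> : (fun n => c n / h n) =
    (fun n => c n / h n - dphi * ((I n / F (h n)) / (mean n / F (h n)))) \+
    (fun n => dphi * ((I n / F (h n)) / (mean n / F (h n)))).
  by apply/funext => n /=; rewrite subrK.
by rewrite -[X in _ --> X]add0r; exact: cvgD.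
Unshelve. all: by end_near. Qed.

Lemma expectation_kernel_estimate :
  exists a b : nat -> R,
    [/\ a =O_\oo (fun n => (n%:R * F (h n))^-1),
        b =o_\oo h
      & \forall n \near \oo,
          ('E_P[rhat n] - (r chi)%:E =
           (dphi * (M0 K tau0 / M1 K tau0) * h n + a n + b n)%:E)%E].
Proof.
(* The noise being centered, the mean is [r chi + c n + bias n]. Thus [bias n] is the [O(1 / N)]
   term, and the error of the linear approximation of [c n] is the [o(h)] term. *)
pose bias n := \int[P]_w bias_part P Z Z0 psi (kap n) n rho (r chi) w.
exists bias, (fun n => c n - dphi * (M0 K tau0 / M1 K tau0) * h n); split.
- apply/eqO_exP; exists (bias_cst (K 0) (K 1) (r chi)).
    rewrite /bias_cst ltr_wpDr ?mulr_ge0 ?addr_ge0//.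
    by rewrite ltr_wpDl// mulr_ge0// sqr_ge0.
  near=> n.
  have Nn : 0 < N n by near: n; exact: N_gt0.
  have N1 : 1 <= N n by near: n; exact: N_ge.
  (* Boundedness is enough for an [O(1 / N)], so [delta] is fixed to 1. *)
  have rho1 u : A n u -> `|rho u| <= 1.
    by move: u; near: n; exact: (rho_small ltr01).
  rewrite [X in _ <= _ * X]ger0_norm ?invr_ge0 ?(ltW Nn)//.
  exact: (mean_bias_part_rate hiid mpsi (mkap n) (mA n) K1_gt0 (@kapA n)
    (@kapNA n) Nn mrho ler01 rho1 (r chi) (lexx 1) N1).
- apply/eqoP => t t0.
  move/cvgrPdist_le : local_mean_cvg => /(_ t t0); apply: filterS => n H.
  have hn := h_gt0 n.
  have -> : c n - dphi * (M0 K tau0 / M1 K tau0) * h n =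
      - (dphi * (M0 K tau0 / M1 K tau0) - c n / h n) * h n.
    by field; rewrite !gt_eqF.
  by rewrite normrM normrN ler_wpM2r.
- near=> n.
  have Nn : 0 < N n by near: n; exact: N_gt0.
  have rho1 u : A n u -> `|rho u| <= 1.
    by move: u; near: n; exact: (rho_small ltr01).
  have iest := integrable_estimate hiid mpsi (mkap n) (mA n) K1_gt0 (@kapA n)
    (@kapNA n) Nn mrho ler01 rho1 me ie e0 (r chi).
  rewrite rhatE unlock (EFin_Rintegral iest).
  rewrite (mean_estimate hiid mpsi (mkap n) (mA n) K1_gt0 (@kapA n)
    (@kapNA n) Nn mrho ler01 rho1 me ie e0 (r chi)).
  by rewrite -EFinB; congr (_%:E); rewrite -/(bias n) -/(c n); ring.
Unshelve. all: by end_near. Qed.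

Lemma variance_kernel_estimate :
  exists v : nat -> R,
     v =o_\oo (fun n => (n%:R * F (h n))^-1) /\
     \forall n \near \oo,
       ('V_P[rhat n] =
        ((n%:R * F (h n))^-1 * (M2 K tau0 / M1 K tau0 ^+ 2) * sigma2 chi
         + v n)%:E)%E.
Proof.
pose est n := estimate Z psi (kap n) n rho e (r chi).
pose V n := \int[P]_w ((est n w - \int[P]_w est n w) ^+ 2).
pose L := M2 K tau0 / M1 K tau0 ^+ 2.
(* With the remainder defined as the difference, the expansion itself only requires that the
   variance be finite and equal to [V n]; here again [delta] is 1. *)
exists (fun n => V n - (N n)^-1 * L * sigma2 chi); split; last first.
  near=> n.
  have Nn : 0 < N n by near: n; exact: N_gt0.
  have rho1 u : A n u -> `|rho u| <= 1.
    by move: u; near: n; exact: (rho_small ltr01).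
  have sig1 u : A n u -> `|sigma2 u - sigma2 chi| <= 1.
    by move: u; near: n; exact: (sigma2_small ltr01).
  have iest := integrable_estimate hiid mpsi (mkap n) (mA n) K1_gt0 (@kapA n)
    (@kapNA n) Nn mrho ler01 rho1 me ie e0 (r chi).
  have [iV _] := variance_estimate hiid mpsi (mkap n) (mA n) K1_gt0 (@kapA n)
    (@kapNA n) Nn mrho ler01 rho1 me msig sig_ge0 (sig_ge0 chi) ie e0 e2 sig1
    (r chi) ltr01.
  rewrite addrC subrK rhatE /variance unlock /= unlock.
  transitivity (\int[P]_w ((est n w - \int[P]_w est n w) ^+ 2)%:E)%E.
    by apply: eq_integral => w _; rewrite /= expr2.
  exact: EFin_Rintegral.
pose v n := (\int[P]_w (kap n (X w) ^+ 2)) * F (h n) / mean n ^+ 2.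
have v_cvg : v n @[n --> \oo] --> L.
  have H : (\int[P]_w (kap n (X w) ^+ 2)) / F (h n) /
      (mean n / F (h n)) ^+ 2 @[n --> \oo] --> L.
    apply: cvgM; first exact: mean_sqr_cvg.
    apply: cvgV; first by rewrite expf_eq0/= gt_eqF.
    by rewrite !expr2; apply: cvgM; exact: mean_cvg.
  apply: cvg_trans H; apply: near_eq_cvg; near=> n.
  have Fn0 : 0 < F (h n) by near: n; exact: F_gt0.
  have mn0 : 0 < mean n by near: n; exact: mean_gt0.
  by rewrite /v; field; rewrite !gt_eqF.
pose C := variance_rate_cst (K 0) (K 1) (sigma2 chi) (r chi).
have NV : N n * V n - sigma2 chi * v n @[n --> \oo] --> (0 : R).
  apply/cvgr0Pnorm_le => t t0.
  have C1 : 0 < `|C| + 1 by rewrite ltr_wpDl.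
  (* This is the value given to [delta]. The constant [C] depends on neither [n] nor [delta], so
     [C * s <= t]; adding 1 to [|C|] avoids a division by 0. *)
  pose s := Num.min 1 (t / (`|C| + 1)).
  have s0 : 0 < s by rewrite lt_min ltr01 divr_gt0.
  have s1 : s <= 1 by rewrite ge_min lexx.
  near=> n.
  have Nn : 0 < N n by near: n; exact: N_gt0.
  have Ns : s ^- 2 <= N n by near: n; exact: N_ge.
  have rhos u : A n u -> `|rho u| <= s by move: u; near: n; exact: rho_small.
  have sigs u : A n u -> `|sigma2 u - sigma2 chi| <= s.
    by move: u; near: n; exact: sigma2_small.
  apply: (le_trans (variance_rate hiid mpsi (mkap n) (mA n) K1_gt0 (@kapA n)
    (@kapNA n) Nn mrho (ltW s0) rhos me msig sig_ge0 (sig_ge0 chi) ie e0 e2 sigs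
    (r chi) s0 s1 Ns)).
  apply: (@le_trans _ _ ((`|C| + 1) * s)).
    by rewrite ler_wpM2r ?(ltW s0)// (le_trans (ler_norm _))// lerDl.
  have : s <= t / (`|C| + 1) by rewrite ge_min lexx orbT.
  by rewrite ler_pdivlMr// mulrC.
have NV' : N n * V n @[n --> \oo] --> sigma2 chi * L.
  have -> : (fun n => N n * V n) =
      (fun n => N n * V n - sigma2 chi * v n) \+ (fun n => sigma2 chi * v n).
    by apply/funext => n /=; rewrite subrK.
  rewrite -[X in _ --> X]add0r; apply: cvgD => //.
  by apply: cvgM => //; exact: cvg_cst.
apply/eqoP => t t0; near=> n.
have Nn : 0 < N n by near: n; exact: N_gt0.
have dn : `|sigma2 chi * L - N n * V n| <= t.
  by near: n; move/cvgrPdist_le : NV'; exact.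
have iN : 0 <= (N n)^-1 by rewrite invr_ge0 ltW.
have -> : V n - (N n)^-1 * L * sigma2 chi =
    - (sigma2 chi * L - N n * V n) * (N n)^-1.
  by field; rewrite gt_eqF.
by rewrite normrM normrN ler_wpM2r.
Unshelve. all: by end_near. Qed.

End asymptotics.

Theorem theorem1 (R : realType) (d : measure_display)
  (Omega : measurableType d) (P : probability Omega R)
  (E : completeNormedModType R) (hsep : separable E)
  (Y_ : nat -> Omega -> R) (X_ : nat -> Omega -> E)
  (Y : Omega -> R) (X : Omega -> E)
  (hiid : iid_copies P
     (fun i w => (Y_ i w, X_ i w : borel E)) (fun w => (Y w, X w : borel E)))
  (r sigma2 : E -> R)
  (r_meas : measurable_fun setT (r : borel E -> R))
  (eps : nat -> Omega -> R)
  (hmodel : forall i w, Y_ i w = r (X_ i w) + eps i w)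
  (heps : forall i,
     is_cond_expectation P (eps i) (X_ i : Omega -> borel E) (fun=> 0))
  (heps2 : forall i,
     is_ge0_cond_expectation P (fun w => eps i w ^+ 2)
       (X_ i : Omega -> borel E) sigma2)
  (chi : E) (phi : R -> R)
  (hphi : is_cond_expectation P (fun w => r (X w) - r chi)
     (fun w => `|X w - chi|) phi)
  (phi0 : phi 0 = 0)
  (* (a) *)
  (r_cont : \forall x \near chi, {for x, continuous r})
  (sigma2_cont : \forall x \near chi, {for x, continuous sigma2})
  (F0 : small_ball P X chi 0 = 0)
  (* (b) *)
  (dphi : R) (hdphi : has_derivative_within `[0, +oo[ phi 0 dphi)
  (* (c) *)
  (h : nat -> R) (h_gt0 : forall n, 0 < h n)
  (h_cvg0 : h n @[n --> \oo] --> (0 : R))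
  (nF_cvgy : n%:R * small_ball P X chi (h n) @[n --> \oo] --> +oo)
  (K : R -> R) (hK : admissible_kernel K)
  (* (d) *)
  (tau0 : R -> R)
  (htau : forall s, 0 <= s <= 1 ->
     tau (small_ball P X chi) t s @[t --> 0^'+] --> tau0 s) :
  let F := small_ball P X chi in
  let rhat n := kernel_estimate K Y_ X_ chi (h n) n in
  (exists a b : nat -> R,
    [/\ a =O_\oo (fun n => (n%:R * F (h n))^-1),
        b =o_\oo h
      & \forall n \near \oo,
          ('E_P[rhat n] - (r chi)%:E =
           (dphi * (M0 K tau0 / M1 K tau0) * h n + a n + b n)%:E)%E]) /\
  (exists c : nat -> R,
     c =o_\oo (fun n => (n%:R * F (h n))^-1) /\
     \forall n \near \oo,
       ('V_P[rhat n] =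
        ((n%:R * F (h n))^-1 * (M2 K tau0 / M1 K tau0 ^+ 2) * sigma2 chi
         + c n)%:E)%E).
Proof.
have r_cont' := nbhs_singleton r_cont.
have sigma2_cont' := nbhs_singleton sigma2_cont.
split.
  exact: (expectation_kernel_estimate hiid r_meas hmodel heps hphi phi0 r_cont'
    hdphi h_gt0 h_cvg0 nF_cvgy hK htau).
exact: (variance_kernel_estimate hiid r_meas hmodel heps heps2 r_cont'
  sigma2_cont' h_gt0 h_cvg0 nF_cvgy hK htau).
Qed.
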